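(* Let $E$ be an infinite-dimensional Banach space which has no minimal subspaces. Then $E$ has a tight subspace.
   Context: All Banach spaces are real and infinite-dimensional, and ''subspace'' means infinite-dimensional closed subspace. $\mathbb N=\{0,1,2,\ldots\}$. $[x_n \mid n\in A]$ denotes the closed linear span. $X\sqsubseteq Y$ means that $X$ is isomorphic to a closed subspace of $Y$. ''Basis'' means Schauder basis. A space is minimal if it embeds ($\sqsubseteq$) into each of its (infinite-dimensional closed) subspaces. Let $E$ have basis $(e_n)$. A Banach space $Y$ is tight in the basis $(e_n)$ if there is a sequence of successive non-empty (finite) intervals $I_0<I_1<I_2<\ldots$ of $\mathbb N$ such that for all infinite $A\subseteq\mathbb N$, $Y\not\sqsubseteq[e_n\mid n\notin\bigcup_{i\in A}I_i]$. The basis $(e_n)$ is tight if every infinite-dimensional Banach space $Y$ is tight in $(e_n)$. An infinite-dimensional Banach space is tight if it has a tight basis. *)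

(* Defs.v *)
From HB Require Import structures.
From mathcomp Require Import all_boot all_order all_algebra.
From mathcomp Require Import all_classical all_reals all_analysis.

Set Implicit Arguments.
Unset Strict Implicit.
Unset Printing Implicit Defensive.

Import Order.TTheory GRing.Theory Num.Theory.
Import numFieldNormedType.Exports.

Local Open Scope classical_set_scope.
Local Open Scope ring_scope.

(* A real Banach space is an E : completeNormedModType R with R : realType;
   its subspaces are sets in E, and E itself is the subspace [set: E]. *)

Section Subspaces.
Context {R : realType} {E : completeNormedModType R}.
Implicit Types (A X : set E) (e : nat -> E).

Definition lspan A : set E :=
  [set x | exists n (v : 'I_n -> E) (c : 'I_n -> R),
    (forall i, A (v i)) /\ x = \sum_(i < n) c i *: v i].

Definition closed_lspan A : set E := closure (lspan A).

Definition infinite_dim X : Prop :=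
  ~ exists S : set E, finite_set S /\ X `<=` lspan S.

Definition closed_subspace X : Prop := submod_closed [in X] /\ closed X.

Definition banach_subspace X : Prop := closed_subspace X /\ infinite_dim X.

Definition schauder_basis X e : Prop :=
  (forall n, X (e n)) /\
  forall x, X x ->
    exists! a : nat -> R, series (fun n => a n *: e n) @ \oo --> x.

End Subspaces.

Section Embeddings.
Context {R : realType} {E F : completeNormedModType R}.

Definition linear_on (X : set E) (f : E -> F) : Prop :=
  forall (a : R) (x y : E), X x -> X y -> f (a *: x + y) = a *: f x + f y.

(* Only the values of f on X and of g on Z matter. *)
Definition isomorphic (X : set E) (Z : set F) : Prop :=
  exists (f : E -> F) (g : F -> E),
    [/\ set_fun X Z f, set_fun Z X g,
        {in X, cancel f g} & {in Z, cancel g f}] /\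
    [/\ linear_on X f, {within X, continuous f} & {within Z, continuous g}].

Definition embeds (X : set E) (Y : set F) : Prop :=
  exists Z : set F, [/\ Z `<=` Y, closed_subspace Z & isomorphic X Z].

End Embeddings.

Definition minimal_space {R : realType} {E : completeNormedModType R}
    (X : set E) : Prop :=
  forall Y : set E, Y `<=` X -> banach_subspace Y -> embeds X Y.

Definition successive_intervals (I : nat -> set nat) : Prop :=
  (forall i, exists a b : nat,
     (a <= b)%N /\ I i = [set n | (a <= n <= b)%N]) /\
  (forall i m n, I i m -> I i.+1 n -> (m < n)%N).

Definition tight_in {R : realType} {E : completeNormedModType R}
    (Y : completeNormedModType R) (e : nat -> E) : Prop :=
  exists I : nat -> set nat, successive_intervals I /\
    forall A : set nat, infinite_set A ->
      ~ embeds [set: Y] (closed_lspan (e @` ~` (\bigcup_(i in A) I i))).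

Definition tight_basis {R : realType} {E : completeNormedModType R}
    (X : set E) (e : nat -> E) : Prop :=
  schauder_basis X e /\
  forall Y : completeNormedModType R, infinite_dim [set: Y] -> tight_in Y e.

Definition tight_space {R : realType} {E : completeNormedModType R}
    (X : set E) : Prop :=
  exists e : nat -> E, tight_basis X e.

(* Main.v *)
(* Fix a basic sequence (e_n) of E and consider rational block sequences z of it.
   If no block subspace is tight then, for every z, some block sequence y of z
   is such that, for some constant C, player II can embed y into z with
   constant C in the game where player I requires the successive vectors used by
   II to lie further and further out: the positions from which every sequence of
   intervals is avoided infinitely often by a partial embedding of y are closed
   under the moves of the game, because only countably many moves are available
   and countably many sequences of intervals can be diagonalised.
   For z let rho z be the set of pairs (position, finite list a of vectors) for
   which II survives in z against the requests from a followed by some block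
   sequence of z. It is monotone in z up to finitely many vectors and takes
   values in the subsets of a countable set, so it is constant below some x0.
   Another diagonalisation yields L below x0 such that, from any state in rho,
   all vectors of L that are far enough may be added to the list a. Now choose y
   in L that embeds in L by the game. For any z below y, play both games at
   once: y embeds into a sum of chunks of L, each chosen far enough for the
   current state, and these chunks embed into z. Hence y spans a minimal space. *)

Require Import Defs.
From mathcomp Require Import all_boot all_order all_algebra.
From mathcomp Require Import all_classical all_reals all_analysis.
From mathcomp Require Import ring lra zify.

Set Implicit Arguments.
Unset Strict Implicit.
Unset Printing Implicit Defensive.

Import Order.TTheory GRing.Theory Num.Theory.
Import numFieldNormedType.Exports.

Local Open Scope classical_set_scope.
Local Open Scope ring_scope.

(** * Linear spans over an arbitrary ring *)

Section Span.
Context {K : pzRingType} {U : lmodType K}.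
Implicit Types (S T : set U) (x y : U) (a : K).

(** Rational codes, real vectors and pairs of vectors all need spans, so the ring is arbitrary; the
    inductive form allows induction on a combination. [lspanE] links it to [lspan]. *)
Inductive span S : U -> Prop :=
| span0 : span S 0
| span_cons a x y : S x -> span S y -> span S (a *: x + y).

Lemma span_comb S a x y : span S x -> span S y -> span S (a *: x + y).
Proof.
move=> Sx; elim: Sx y => [y Sy|b z w Sz _ IH y Sy]; first by rewrite scaler0 add0r.
by rewrite scalerDr scalerA -addrA; apply: span_cons => //; apply: IH.
Qed.

Lemma span_incl S x : S x -> span S x.
Proof.
by move=> Sx; rewrite -[x]addr0 -[x]scale1r; apply: span_cons => //; exact: span0.
Qed.

Lemma spanD S x y : span S x -> span S y -> span S (x + y).
Proof. by move=> Sx Sy; rewrite -[x]scale1r; apply: span_comb. Qed.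

Lemma spanZ S a x : span S x -> span S (a *: x).
Proof. by move=> Sx; rewrite -[_ *: _]addr0; apply: span_comb => //; exact: span0. Qed.

Lemma spanB S x y : span S x -> span S y -> span S (x - y).
Proof. by move=> Sx Sy; rewrite addrC -scaleN1r; apply: span_comb. Qed.

Lemma span_trans S T : S `<=` span T -> span S `<=` span T.
Proof.
move=> ST x; elim=> [|a y z Sy _ IH]; first exact: span0.
by apply: span_comb => //; exact: ST.
Qed.

Lemma span_mono S T : S `<=` T -> span S `<=` span T.
Proof. by move=> ST; apply: span_trans => x /ST /span_incl. Qed.

Lemma spanU S T x : span (S `|` T) x ->
  exists y z, [/\ span S y, span T z & x = y + z].
Proof.
elim=> [|a y z STy _ [u [v [Su Tv ->]]]].
  by exists 0, 0; split; [exact: span0|exact: span0|rewrite addr0].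
case: STy => [Sy|Ty].
  by exists (a *: y + u), v; split => //; [exact: span_cons|rewrite addrA].
by exists u, (a *: y + v); split => //; [exact: span_cons|rewrite addrCA].
Qed.

Lemma span_sum S (I : Type) (r : seq I) (P : pred I) (F : I -> U) :
  (forall i, P i -> span S (F i)) -> span S (\sum_(i <- r | P i) F i).
Proof. by move=> SF; apply: big_ind => //; [exact: span0|exact: spanD]. Qed.

Lemma span_bounded_support S (z : nat -> U) (P : set nat) x :
  span (S `|` (z @` P)) x ->
  exists m, span (S `|` (z @` (P `&` [set i | (i < m)%N]))) x.
Proof.
elim=> [|a y w Sy _ [m Hw]]; first by exists 0%N; exact: span0.
have mon k l : (k <= l)%N ->
    S `|` (z @` (P `&` [set i | (i < k)%N])) `<=`
    S `|` (z @` (P `&` [set i | (i < l)%N])).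
  move=> kl; apply: setUS; apply: image_subset; apply: setIS => i /= ik.
  exact: leq_trans ik kl.
case: Sy => [Sy|[i Pi <-]].
  by exists m; apply: span_cons => //; left.
exists (maxn m i.+1); apply: span_cons.
  by right; exists i => //; split => //=; rewrite leq_max leqnn orbT.
by apply: span_mono Hw; apply: mon; exact: leq_maxl.
Qed.

End Span.

Section SpanMap.
Context {K K' : pzRingType} {U : lmodType K} {U' : lmodType K'}.
Variables (h : K -> K') (f : U -> U').
Hypothesis f0 : f 0 = 0.
Hypothesis fE : forall a x y, f (a *: x + y) = h a *: f x + f y.

(** Scalars may change along [h], because the evaluation [ev] of rational vectors is linear only
    through [ratr]. *)
Lemma span_map (S : set U) x : span S x -> span (f @` S) (f x).
Proof.
elim=> [|a y z Sy _ IH]; first by rewrite f0; exact: span0.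
by rewrite fE; apply: span_cons => //; exists y.
Qed.

End SpanMap.

Section SpanLift.
Context {K : pzRingType} {U U' : lmodType K}.

Lemma span_linear (f : {linear U -> U'}) (S : set U) x : span S x -> span (f @` S) (f x).
Proof. by apply: (span_map (h := id)); [exact: linear0|exact: linearP]. Qed.

Lemma span_lift (f : {linear U -> U'}) (S : set U) y :
  span (f @` S) y -> exists2 x, span S x & f x = y.
Proof.
elim=> [|a _ z [x Sx <-] _ [w Sw <-]]; first by exists 0; [exact: span0|rewrite linear0].
by exists (a *: x + w); [exact: span_cons|rewrite linearP].
Qed.

End SpanLift.

(** * Block sequences of rational vectors *)

(* A finitely supported rational vector is encoded as a polynomial over rat,
   'X^i being the i-th unit vector; thus [size v] bounds the support of v. *)
Notation vec := {poly rat}.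

Definition above (n : nat) (v : vec) := forall i, (i < n)%N -> v`_i = 0.

Definition block (z : nat -> vec) :=
  forall n, z n != 0 /\ above (size (z n)) (z n.+1).

Definition bspan (z : nat -> vec) : set vec := span (range z).

Lemma above_leq m n v : (m <= n)%N -> above n v -> above m v.
Proof. by move=> mn nv i im; apply: nv; exact: leq_trans im mn. Qed.

Lemma above_size_eq0 n v : above n v -> (size v <= n)%N -> v = 0.
Proof.
move=> nv vn; apply/polyP => i; rewrite coef0.
by case: (ltnP i n) => [/nv//|ni]; rewrite nth_default// (leq_trans vn ni).
Qed.

Lemma above_size n v : above n v -> v != 0 -> (n < size v)%N.
Proof.
move=> nv; apply: contra_neqT; rewrite -leqNgt => /(above_size_eq0 nv) -> //.
Qed.

Lemma above_comb n a v w : above n v -> above n w -> above n (a *: v + w).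
Proof. by move=> nv nw i lin; rewrite coefD coefZ nv// nw// mulr0 addr0. Qed.

Lemma span_above n (S : set vec) v : S `<=` above n -> span S v -> above n v.
Proof.
move=> Sn; elim=> [i _|a x y Sx _ IH]; first by rewrite coef0.
by apply: above_comb => //; exact: Sn.
Qed.

Lemma span_size n (S : set vec) v :
  (forall w, S w -> (size w <= n)%N) -> span S v -> (size v <= n)%N.
Proof.
move=> Sn; elim=> [|a x y Sx _ IH]; first by rewrite size_poly0.
rewrite (leq_trans (size_polyD _ _))// geq_max IH andbT.
by rewrite (leq_trans (size_scale_leq _ _))// Sn.
Qed.

Section Block.
Variable z : nat -> vec.
Hypothesis zb : block z.

Lemma block_lt m n : (m < n)%N -> above (size (z m)) (z n).
Proof.
elim: n => // n IH; rewrite ltnS leq_eqVlt => /predU1P[->|mn].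
  exact: (zb n).2.
by apply: above_leq (zb n).2; apply/ltnW/above_size; [exact: IH|exact: (zb n).1].
Qed.

Lemma block_size_lt m n : (m < n)%N -> (size (z m) < size (z n))%N.
Proof. by move=> mn; apply: above_size (zb n).1; exact: block_lt. Qed.

Lemma block_size_le m n : (m <= n)%N -> (size (z m) <= size (z n))%N.
Proof. by rewrite leq_eqVlt => /predU1P[->//|/block_size_lt/ltnW]. Qed.

Lemma block_size n : (n < size (z n))%N.
Proof.
elim: n => [|n IH]; first by rewrite size_poly_gt0 (zb 0).1.
exact: leq_trans (block_size_lt (ltnSn n)).
Qed.

Lemma block_above n : above n (z n).
Proof.
by case: n => // n; apply: above_leq (block_size n) _; exact: (zb n).2.
Qed.

Lemma block_incl n : bspan z (z n).
Proof. by apply: span_incl; exists n. Qed.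

(** Split [v = x + y] with [x] built from indices up to [k] and [y] from later ones. Then
    [x = v - y] has no coefficient below [size (z k)], and as a combination of early vectors it has
    none from there on, so it vanishes. *)
Lemma bspan_tail k v : bspan z v -> above (size (z k)) v ->
  span (z @` [set i | (k < i)%N]) v.
Proof.
move=> zv kv.
have : span ((z @` [set i | (i <= k)%N]) `|` (z @` [set i | (k < i)%N])) v.
  apply: span_mono zv => _ [i _ <-].
  by case: (leqP i k) => ik; [left|right]; exists i.
move=> /spanU[x [y [Sx Sy vE]]].
suff x0 : x = 0 by rewrite vE x0 add0r.
apply: (@above_size_eq0 (size (z k))); last first.
  by apply: span_size Sx => _ [i ik <-]; exact: block_size_le.
have -> : x = (-1) *: y + v by rewrite vE scaleN1r addrC addrK.
apply: above_comb => //; apply: span_above Sy => _ [i ki <-]; exact: block_lt.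
Qed.

Lemma block_shift k : block (fun n => z (k + n)%N).
Proof. by move=> n; rewrite addnS; exact: zb. Qed.

End Block.

Lemma bspan_sub z z' : (forall n, bspan z (z' n)) -> bspan z' `<=` bspan z.
Proof. by move=> zz'; apply: span_trans => _ [n _ <-]; exact: zz'. Qed.

(** Inclusion modulo finitely many vectors, measured by supports rather than by indices; this much
    survives a diagonalisation. *)
Definition almost_sub (z' z : nat -> vec) :=
  exists n, forall v, bspan z' v -> above n v -> bspan z v.

Lemma almost_tail z z' : block z' -> almost_sub z' z ->
  exists y, [/\ block y, bspan y `<=` bspan z', bspan y `<=` bspan z & almost_sub z' y].
Proof.
move=> z'b [n sub]; exists (fun i => z' (n + i)%N); split.
- exact: block_shift.
- by apply: bspan_sub => i /=; exact: block_incl.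
- apply: bspan_sub => i /=; apply: sub; first exact: block_incl.
  exact: above_leq (leq_addr i n) (@block_above _ z'b (n + i)%N).
- exists (size (z' n)) => v z'v nv.
  have := bspan_tail z'b z'v nv; apply: span_mono => _ [i /= ni <-].
  by exists (i - n)%N => //; rewrite subnKC// ltnW.
Qed.

Lemma block_diag (Z : nat -> nat -> vec) :
  (forall k, block (Z k)) -> (forall k, bspan (Z k.+1) `<=` bspan (Z k)) ->
  exists L, [/\ block L, bspan L `<=` bspan (Z 0%N) & forall k, almost_sub L (Z k)].
Proof.
move=> Zb ZS.
(* By [block_above], the term of index [size (L k')] starts beyond the support of [L k']. *)
pose fix L k := if k is k'.+1 then Z k (size (L k')) else Z 0%N 0%N.
have ZS' k l : (k <= l)%N -> bspan (Z l) `<=` bspan (Z k).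
  elim: l => [|l IH]; first by rewrite leqn0 => /eqP->.
  by rewrite leq_eqVlt => /predU1P[->//|/IH lk]; apply: subset_trans (ZS l) lk.
have LZ k : bspan (Z k) (L k) by case: k => [|k]; exact: block_incl.
have Lb : block L.
  move=> n; split; last exact: block_above.
  by case: n => [|n] /=; exact: (Zb _ _).1.
exists L; split => //.
  by apply: bspan_sub => k; apply: (ZS' 0%N k).
move=> k; exists (size (L k)) => v Lv /(bspan_tail Lb Lv).
by apply: span_trans => _ [i /= ki <-]; apply: (ZS' k i) => //; exact: ltnW.
Qed.

(** * The embedding game *)

(** A state [(C, f, a, p)] records the constant, the vectors at the disposal of II, the extra
    vectors that I may ask for, and the answers given. The type is countable, so that states can be
    enumerated by [unpickle]. *)
Definition state := (nat * seq vec * seq vec * seq (vec * vec))%type.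

Section Game.
Variable partial_emb : nat -> seq (vec * vec) -> Prop.

(* [Win C z A f p]: in the game where player I asks for the images of elements
   of [A] and imposes larger and larger lower bounds on the supports of the
   vectors of [bspan z] that player II may use, player II can keep the list [p]
   of answers given so far a [partial_emb C] forever; [f] lists the vectors that
   II has had at their disposal until now. *)
Definition Win C (z : nat -> vec) (A : set vec) (f : seq vec)
    (p : seq (vec * vec)) : Prop :=
  exists W : seq vec -> seq (vec * vec) -> Prop, W f p /\
    forall f p, W f p -> partial_emb C p /\
      forall n y, A y -> exists g u,
        [/\ forall v, v \in g -> bspan z v /\ above n v,
            span [set` f ++ g] u & W (f ++ g) (rcons p (y, u))].

Lemma Win_partial_emb C z A f p : Win C z A f p -> partial_emb C p.
Proof. by case=> W [Wfp /(_ _ _ Wfp)[]]. Qed.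

Lemma Win_step C z A f p n y : Win C z A f p -> A y -> exists g u,
  [/\ forall v, v \in g -> bspan z v /\ above n v,
      span [set` f ++ g] u & Win C z A (f ++ g) (rcons p (y, u))].
Proof.
move=> [W [Wfp Wstep]] Ay; have [_ /(_ n y Ay)[g [u [zg Su Wg]]]] := Wstep _ _ Wfp.
by exists g, u; split=> //; exists W.
Qed.

(** II follows the strategy for [z'] as if every bound were at least [N]; the vectors received then
    lie in [bspan z] as well. *)
Lemma Win_sub C z z' A A' f p : almost_sub z' z -> A `<=` A' ->
  Win C z' A' f p -> Win C z A f p.
Proof.
move=> [N zz'] AA' [W [Wfp Wstep]]; exists W; split => // f' p' W'.
have [Eqp step] := Wstep _ _ W'; split => // n y /AA' A'y.
have [g [u [zg Su Wg]]] := step (maxn n N) y A'y; exists g, u; split => // v vg.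
have [z'v nv] := zg v vg; split; last by apply: above_leq nv; exact: leq_maxl.
by apply: zz' => //; apply: above_leq nv; exact: leq_maxr.
Qed.

Lemma almost_refl z : almost_sub z z.
Proof. by exists 0%N. Qed.

Lemma almost_subset z z' : bspan z' `<=` bspan z -> almost_sub z' z.
Proof. by move=> zz'; exists 0%N => v /zz'. Qed.

(** * Stabilising the set of states that II survives *)

Definition rho (z : nat -> vec) : set state := [set s : state |
  let: (C, f, a, p) := s in exists y, [/\ block y, bspan y `<=` bspan z
    & Win C z ([set` a] `|` bspan y) f p]].

(** The witness below [z'] is replaced by a tail of it that lies below [z]; having fewer questions
    to face only helps II. *)
Lemma rho_almost z z' : almost_sub z' z -> rho z' `<=` rho z.
Proof.
move=> zz' [[[C f] a] p] [y [yb yz' Wy]].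
have yz : almost_sub y z.
  by case: zz' => n zz'; exists n => v /yz'; exact: zz'.
have [w [wb wy wz yw]] := almost_tail yb yz.
by exists w; split => //; apply: Win_sub Wy => //; exact: setUS.
Qed.

(** Stage [k] passes to a block sequence that loses the state with code [k], if there is one. A
    state still held by the diagonal sequence was therefore impossible to lose at its own stage, and
    every sequence further down holds it. *)
Lemma rho_stable x : block x -> exists x0,
  [/\ block x0, bspan x0 `<=` bspan x &
      forall z, block z -> bspan z `<=` bspan x0 -> rho z = rho x0].
Proof.
move=> xb.
have step (z : nat -> vec) (k : nat) : {z' : nat -> vec | block z ->
    [/\ block z', bspan z' `<=` bspan z &
      forall s, unpickle k = Some s -> rho z' s ->
        forall w, block w -> bspan w `<=` bspan z -> rho w s]}.
  apply: cid; case: (pselect (exists s w, [/\ unpickle k = Some s, block w,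
      bspan w `<=` bspan z & ~ rho w s])) => [[s [w [ks wb wz Nw]]]|H].
    by exists w => _; split => // t; rewrite ks => -[<-].
  exists z => zb; split => // s ks _ w wb wz.
  by apply: contrapT => Nw; apply: H; exists s, w.
pose fix Z k := if k is k'.+1 then sval (step (Z k') k') else x.
have ZP k : block (Z k) /\ (bspan (Z k.+1) `<=` bspan (Z k)).
  have Zb : block (Z k).
    by elim: k => [//|k IH]; have [] := svalP (step (Z k) k) IH.
  by split => //; have [] := svalP (step (Z k) k) Zb.
have [L [Lb LZ0 LZ]] := block_diag (fun k => (ZP k).1) (fun k => (ZP k).2).
exists L; split => // z zb zL; apply/seteqP; split => s; first exact/rho_almost/almost_subset.
move=> Ls; set k := pickle s.
have Zs : rho (Z k.+1) s by exact: rho_almost (LZ k.+1) _ Ls.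
have zZ : almost_sub z (Z k) by case: (LZ k) => n H; exists n => v /zL; exact: H.
have [w [wb wz wZ _]] := almost_tail zb zZ.
have ws : rho w s.
  have [_ _ H] := svalP (step (Z k) k) (ZP k).1.
  by apply: (H s _ Zs w wb wZ); rewrite pickleK.
exact: (rho_almost (almost_subset wz)).
Qed.

Section Stable.
Variable x0 : nat -> vec.
Hypothesis x0b : block x0.
Hypothesis x0S : forall z, block z -> bspan z `<=` bspan x0 -> rho z = rho x0.

(** By stability a state of [rho x0] has witnesses below any block sequence under [x0], so stage [k]
    can pass to a witness for the state with code [k]. Far vectors of the diagonal sequence belong
    to that witness and are legitimate questions. *)
Lemma rho_fusion : exists L, [/\ block L, bspan L `<=` bspan x0 &
  forall C f a p, rho x0 (C, f, a, p) -> exists k, forall a',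
    (forall v, v \in a' -> bspan L v /\ above k v) -> rho x0 (C, f, a ++ a', p)].
Proof.
have step (z : nat -> vec) (k : nat) : {z' : nat -> vec |
    block z -> bspan z `<=` bspan x0 ->
    [/\ block z', bspan z' `<=` bspan z &
      forall C f a p, unpickle k = Some ((C, f, a, p) : state) ->
        rho x0 (C, f, a, p) -> Win C x0 ([set` a] `|` bspan z') f p]}.
  apply: cid; case E : (unpickle k) => [[[[C f] a] p]|]; last by exists z => zb _; split.
  case: (pselect (rho x0 (C, f, a, p))) => [x0s|Ns]; last first.
    by exists z => zb _; split => // ? ? ? ? [<- <- <- <-].
  case: (pselect (block z /\ bspan z `<=` bspan x0)) => [[zb zx0]|N]; last first.
    by exists z => zb zx0; case: N.
  move: (x0s); rewrite -(x0S zb zx0) => -[y [yb yz Wy]].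
  exists y => _ _; split => // ? ? ? ? [<- <- <- <-] _.
  exact: Win_sub (almost_subset zx0) _ Wy.
pose fix Z k := if k is k'.+1 then sval (step (Z k') k') else x0.
have ZP k : block (Z k) /\ bspan (Z k) `<=` bspan x0.
  elim: k => [|k [IH1 IH2]]; [by split|have [wb wZ _] := svalP (step (Z k) k) IH1 IH2].
  by split => //; exact: subset_trans wZ IH2.
have ZS k : bspan (Z k.+1) `<=` bspan (Z k).
  by have [Zb Zx0] := ZP k; have [] := svalP (step (Z k) k) Zb Zx0.
have [L [Lb LZ0 LZ]] := block_diag (fun k => (ZP k).1) ZS.
exists L; split => // C f a p x0s.
set k := pickle ((C, f, a, p) : state); have [n LZk] := LZ k.+1.
exists n => a' a'L; exists (Z k.+1); split; [exact: (ZP k.+1).1|exact: (ZP k.+1).2|].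
have [Zb Zx0] := ZP k.
have : Win C x0 ([set` a] `|` bspan (Z k.+1)) f p.
  by have [_ _] := svalP (step (Z k) k) Zb Zx0; apply => //; exact: pickleK.
apply: Win_sub; first exact: almost_refl.
move=> v [/=|Zv]; last by right.
rewrite mem_cat => /orP[va|va']; first by left.
by right; have [Lv nv] := a'L _ va'; exact: LZk.
Qed.

(** Stability confines the answer to [z]: the state belongs to [rho z], and after the answer it does
    so again. *)
Lemma rho_ask C f a p z y n : block z -> bspan z `<=` bspan x0 ->
  rho x0 (C, f, a, p) -> y \in a -> exists g u,
  [/\ forall v, v \in g -> bspan z v /\ above n v,
      span [set` f ++ g] u & rho x0 (C, f ++ g, a, rcons p (y, u))].
Proof.
move=> zb zx0; rewrite -(x0S zb zx0) => -[w [wb wz Ww]] ya.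
have [g [u [gz Su Wu]]] := Win_step n Ww (or_introl ya).
by exists g, u; split => //; exists w.
Qed.

Lemma rho_partial_emb C f a p : rho x0 (C, f, a, p) -> partial_emb C p.
Proof. by case=> w [_ _ /Win_partial_emb]. Qed.

Lemma rho_asks C f a p z (l : seq vec) : block z -> bspan z `<=` bspan x0 ->
  (forall v, v \in f -> bspan z v) ->
  rho x0 (C, f, a, p) -> {subset l <= a} -> exists f' q,
  [/\ forall v, v \in f' -> bspan z v, forall w, w \in q -> bspan z w.2,
     map fst q = l & rho x0 (C, f', a, p ++ q)].
Proof.
move=> zb zx0; elim: l f p => [|y l IH] f p fz xp la.
  by exists f, [::]; split => //; rewrite cats0.
have [|g [u [gz Su xu]]] := @rho_ask C f a p z y 0 zb zx0 xp.
  by apply: la; rewrite mem_head.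
have fgz v : v \in f ++ g -> bspan z v.
  by rewrite mem_cat => /orP[/fz//|/gz[]].
have [|f' [q [f'z qz ql xq]]] := IH _ _ fgz xu.
  by move=> v vl; apply: la; rewrite inE vl orbT.
exists f', ((y, u) :: q); split => //=; last by rewrite -cat_rcons.
- move=> w; rewrite inE => /predU1P[->|/qz//] /=.
  by move: Su; apply: (span_trans (T := range z)) => v /=; exact: fgz.
- by rewrite ql.
Qed.

End Stable.

(* The two-step composition behind the dichotomy: [y] embeds into chunks of [L]
   lying beyond any prescribed bounds, and such chunks embed into any [z]. *)
Lemma game_minimal x : block x ->
  (forall z, block z -> bspan z `<=` bspan x -> exists C y,
    [/\ block y, bspan y `<=` bspan z & Win C z (bspan y) [::] [::]]) ->
  exists y, [/\ block y, bspan y `<=` bspan x &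
    forall z, block z -> bspan z `<=` bspan y ->
    exists C (p q : nat -> seq (vec * vec)),
    [/\ forall n, exists2 s, p n.+1 = rcons (p n) s & s.1 = y n,
        forall n, exists s, q n.+1 = q n ++ s,
        forall n, partial_emb C (p n) /\ partial_emb C (q n),
        forall n s, s \in p n -> span [set` map fst (q n)] s.2 &
        forall n s, s \in q n -> bspan z s.2] /\ p 0%N = [::]].
Proof.
move=> xb M; have [x0 [x0b x0x x0S]] := rho_stable xb.
have [C x0C] : exists C, rho x0 (C, [::], [::], [::]).
  have [C [y [yb yx0 Wy]]] := M x0 x0b x0x; exists C, y; split => //.
  by apply: Win_sub Wy; [exact: almost_refl|move=> v []].
have [L [Lb Lx0 LF]] := rho_fusion x0b x0S.
move: (x0C); rewrite -(x0S _ Lb Lx0) => -[y [yb yL Wy]].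
exists y; split => //; first exact/(subset_trans yL)/(subset_trans Lx0).
move=> z zb zy; have zx0 : bspan z `<=` bspan x0.
  exact/(subset_trans zy)/(subset_trans yL).
set A := _ `|` _ in Wy.
(* A joint position [(f, p, f', q)]: [f] and [p] belong to the game of [y] in [L], while [f'] and
   [q] belong to the game in [z], whose questions so far are exactly the vectors of [f]. *)
pose T := (seq vec * seq (vec * vec) * seq vec * seq (vec * vec))%type.
pose inv (t : T) := let: (f, p, f', q) := t in
  [/\ Win C L A f p, rho x0 (C, f', f, q), map fst q = f,
      forall s, s \in p -> span [set` f] s.2 &
      (forall v, v \in f' -> bspan z v) /\ (forall s, s \in q -> bspan z s.2)].
have step (t : T) (k : nat) : {t' : T | inv t -> inv t' /\
    (exists2 s, t'.1.1.2 = rcons t.1.1.2 s & s.1 = y k) /\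
    exists s, t'.2 = t.2 ++ s}.
  apply: cid; case: t => [[[f p] f'] q].
  case: (pselect (inv (f, p, f', q))) => [[Wp xq qf pf [f'z qz]]|N]; last first.
    by exists (f, p, f', q).
  (* The outer game is given the bound [n] beyond which all vectors of [L] may be asked in the inner
     game, so its chunk [g] can be passed on entirely. *)
  have [n Hn] := LF _ _ _ _ xq.
  have Ayk : A (y k) by right; exact: block_incl.
  have [g [u [gL Su Wu]]] := Win_step n Wp Ayk.
  have [|f2 [q' [f2z q'z q'g xq']]] := rho_asks x0S zb zx0 f'z (Hn g gL) (l := g).
    by move=> v vg; rewrite mem_cat vg orbT.
  exists (f ++ g, rcons p (y k, u), f2, q ++ q') => _; split; last first.
    by split; [exists (y k, u)|exists q'].
  split=> //.
  - by rewrite map_cat qf q'g.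
  - move=> s; rewrite mem_rcons inE => /predU1P[->//|/pf]; apply: span_mono => v /=.
    by rewrite mem_cat => ->.
  - by split => // s; rewrite mem_cat => /orP[/qz|/q'z].
pose fix F k := if k is k'.+1 then sval (step (F k') k') else ([::], [::], [::], [::]).
have FI k : inv (F k).
  by elim: k => [|k IH]; [split|have [] := svalP (step (F k) k) IH].
have FS k : (exists2 s, (F k.+1).1.1.2 = rcons (F k).1.1.2 s & s.1 = y k) /\
    exists s, (F k.+1).2 = (F k).2 ++ s.
  by have [] := svalP (step (F k) k) (FI k).
exists C, (fun k => (F k).1.1.2), (fun k => (F k).2); split => //; split.
- by move=> k; exact: (FS k).1.
- by move=> k; exact: (FS k).2.
- move=> k; have := FI k; case: (F k) => [[[f p] f'] q] [Wp xq _ _ _] /=.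
  by split; [exact: Win_partial_emb Wp|exact: rho_partial_emb xq].
- by move=> k s; have := FI k; case: (F k) => [[[f p] f'] q] [_ _ -> pf _] /=; exact: pf.
- by move=> k s; have := FI k; case: (F k) => [[[f p] f'] q] [_ _ _ _ [_ +]] /=; exact.
Qed.

End Game.

(** * Relations inducing isomorphisms of closed spans *)

Section Norm.
Context {R : realType}.

Lemma closure_normP (E : normedModType R) (A : set E) x :
  closure A x <-> forall e, 0 < e -> exists2 y, A y & `|x - y| < e.
Proof.
split=> [Ax e e0|H].
  have [y [Ay]] := Ax _ (nbhsx_ballx x e e0).
  by rewrite -ball_normE /= => ?; exists y.
move=> B /nbhs_ballP[e /= e0 eB]; have [y Ay xy] := H e e0.
by exists y; split => //; apply: eB; rewrite -ball_normE.
Qed.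

Lemma lspanE (E : completeNormedModType R) (A : set E) : lspan A = span A.
Proof.
apply/seteqP; split => x.
  move=> [n [v [c [Av ->]]]]; apply: span_sum => i _.
  exact/spanZ/span_incl.
elim=> [|a y z Ay _ [n [v [c [Av ->]]]]].
  by exists 0%N, (fun=> 0), (fun=> 0); split; [case|rewrite big_ord0].
exists n.+1, (fun i => oapp v y (unlift ord0 i)), (fun i => oapp c a (unlift ord0 i)).
split; first by move=> i; case: (unlift _ _).
rewrite big_ord_recl unlift_none /=; congr (_ + _).
by apply: eq_bigr => i _; rewrite liftK.
Qed.

Lemma closed_lspanE (E : completeNormedModType R) (A : set E) :
  closed_lspan A = closure (span A).
Proof. by rewrite /closed_lspan lspanE. Qed.

Lemma closure_span_comb (E : normedModType R) (A : set E) a x y :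
  closure (span A) x -> closure (span A) y -> closure (span A) (a *: x + y).
Proof.
move=> /closure_normP Ax /closure_normP Ay; apply/closure_normP => e e0.
(* Adding 1 keeps the divisor positive when [a] is 0. *)
have a1 : 0 < `|a| + 1 by rewrite ltr_wpDl.
have [u Au xu] := Ax (e / 2 / (`|a| + 1)) (divr_gt0 (divr_gt0 e0 (ltr0Sn _ 1) ) a1).
have [v Av yv] := Ay (e / 2) (divr_gt0 e0 (ltr0Sn _ 1)).
exists (a *: u + v); first exact: span_comb.
rewrite opprD addrACA -scalerBr (le_lt_trans (ler_normD _ _))// normrZ.
rewrite [e in _ < e]splitr ler_ltD// (@le_trans _ _ ((`|a| + 1) * `|x - u|))//.
  by rewrite ler_wpM2r// lerDl.
by rewrite mulrC -ler_pdivlMr// ltW.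
Qed.

Lemma closed_lspan_subspace (E : completeNormedModType R) (A : set E) :
  closed_subspace (closed_lspan A).
Proof.
rewrite closed_lspanE; split; last exact: closed_closure.
split; first by rewrite inE; apply: subset_closure; exact: span0.
by move=> a x y; rewrite !inE; exact: closure_span_comb.
Qed.

Lemma closed_lspan_min (E : completeNormedModType R) (A X : set E) :
  closed_subspace X -> A `<=` X -> closed_lspan A `<=` X.
Proof.
move=> [[X0 Xc] cX] AX; rewrite closed_lspanE.
have sX : span A `<=` X.
  move=> x; elim=> [|a y z Ay _ Xz]; first by rewrite inE in X0.
  by have := Xc a y z; rewrite !inE; apply => //; exact: AX.
by rewrite (proj1 (closure_id X) cX); exact: closure_subset.
Qed.

End Norm.

Section Lip.
Context {R : realType}.

(** A bounded linear map is presented by a set of pairs. The bound on its span already forces the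
    span to be a graph, so neither independence nor well-definedness has to be checked
    separately. *)
Definition Lip {E F : normedModType R} (C : R) (P : set (E * F)) :=
  forall w, span P w -> `|w.2| <= C * `|w.1|.

Definition biLip {E F : normedModType R} (C : R) (P : set (E * F)) :=
  forall w, span P w -> `|w.2| <= C * `|w.1| /\ `|w.1| <= C * `|w.2|.

Definition flip {E F : Type} (P : set (E * F)) : set (F * E) :=
  [set w | P (w.2, w.1)].

(** The closure of the graph spanned by [P], which represents the continuous extension to the closed
    span. *)
Definition gclosure {E F : normedModType R} (P : set (E * F)) x y :=
  forall e, 0 < e -> exists w, [/\ span P w, `|x - w.1| < e & `|y - w.2| < e].

Lemma flip_span (E F : normedModType R) (P : set (E * F)) w :
  span P w -> span (flip P) (w.2, w.1).
Proof.
elim=> [|a y z Py _ IH]; first exact: span0.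
by apply: (@span_cons _ _ (flip P) a (y.2, y.1) (z.2, z.1)) => //; case: y Py.
Qed.

Lemma span_flip (E F : normedModType R) (P : set (E * F)) w :
  span (flip P) w <-> span P (w.2, w.1).
Proof.
split=> [/flip_span|/flip_span]; last by case: w.
by congr (span _ _); apply/seteqP; split => -[].
Qed.

Section Rel.
Context {E F : normedModType R}.
Implicit Types (P : set (E * F)) (C : R).

Lemma biLip_Lip C P : biLip C P -> Lip C P.
Proof. by move=> H w /H[]. Qed.

Lemma biLip_flip C P : biLip C P -> biLip C (flip P).
Proof. by move=> H w /span_flip /H[]. Qed.

Lemma biLip_sub C P Q : P `<=` span Q -> biLip C Q -> biLip C P.
Proof. by move=> PQ H w /(span_trans PQ) /H. Qed.

Lemma biLip_le C C' P : C <= C' -> biLip C P -> biLip C' P.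
Proof.
move=> CC H w /H[H1 H2].
by split; [apply: le_trans H1 _|apply: le_trans H2 _]; rewrite ler_wpM2r.
Qed.

Lemma gclosure_flip P x y : gclosure P x y <-> gclosure (flip P) y x.
Proof.
split=> H e /H[w [Pw xw yw]]; exists (w.2, w.1); split => //.
  by apply/span_flip; case: w Pw {xw yw}.
exact/span_flip.
Qed.

Lemma gclosure_comb P a x y x' y' :
  gclosure P x y -> gclosure P x' y' -> gclosure P (a *: x + x') (a *: y + y').
Proof.
move=> H H' e e0; have a1 : 0 < `|a| + 1 by rewrite ltr_wpDl.
have [w [Pw xw yw]] := H (e / 2 / (`|a| + 1)) (divr_gt0 (divr_gt0 e0 (ltr0Sn _ 1) ) a1).
have [v [Pv xv yv]] := H' (e / 2) (divr_gt0 e0 (ltr0Sn _ 1)).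
exists (a *: w + v); split => /=; first exact: span_comb.
- rewrite opprD addrACA -scalerBr (le_lt_trans (ler_normD _ _))// normrZ.
  rewrite [e in _ < e]splitr ler_ltD// (@le_trans _ _ ((`|a| + 1) * `|x - w.1|))//.
    by rewrite ler_wpM2r// lerDl.
  by rewrite mulrC -ler_pdivlMr// ltW.
- rewrite opprD addrACA -scalerBr (le_lt_trans (ler_normD _ _))// normrZ.
  rewrite [e in _ < e]splitr ler_ltD// (@le_trans _ _ ((`|a| + 1) * `|y - w.2|))//.
    by rewrite ler_wpM2r// lerDl.
  by rewrite mulrC -ler_pdivlMr// ltW.
Qed.

Lemma gclosure_incl P w : span P w -> gclosure P w.1 w.2.
Proof. by move=> Pw e e0; exists w; rewrite !subrr !normr0. Qed.

Lemma gclosure_Lip C P x y : Lip C P -> gclosure P x y -> `|y| <= C * `|x|.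
Proof.
move=> PC H; apply/ler_addgt0Pr => e e0.
have C1 : 0 < `|C| + 1 by rewrite ltr_wpDl.
have [w [/PC Cw xw yw]] := H (e / 2 / (`|C| + 1)) (divr_gt0 (divr_gt0 e0 (ltr0Sn _ 1) ) C1).
have -> : y = w.2 + (y - w.2) by rewrite addrC subrK.
apply: le_trans (ler_normD _ _) _.
have e2 : `|C| * `|x - w.1| <= e / 2 * (`|C| / (`|C| + 1)).
  by rewrite mulrCA mulrA -mulrA ler_wpM2l// ltW// mulrC.
have Cx : C * `|w.1| <= C * `|x| + `|C| * `|x - w.1|.
  rewrite -lerBlDl -mulrBr (le_trans (ler_norm _))// normrM ler_wpM2l//.
  by rewrite distrC (le_trans (ler_dist_dist _ _)).
have f1 : `|C| / (`|C| + 1) + (`|C| + 1)^-1 = 1.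
  by rewrite -[X in _ + X]mul1r -mulrDl divff// gt_eqF.
have -> : e = e / 2 * (`|C| / (`|C| + 1)) + e / 2 / (`|C| + 1) + e / 2.
  by rewrite -mulrDr f1 mulr1 -splitr.
have e3 : 0 <= e / 2 by rewrite divr_ge0// ltW.
move: Cw Cx e2 yw.
set A := `|w.2|; set B := `|y - w.2|; set D := C * `|w.1|; set G := C * _.
set H1 := `|C| * `|_|; set I := e / 2 * _; set J := e / 2 / _.
lra.
Qed.

Lemma gclosure_fun C P x y y' : Lip C P -> gclosure P x y -> gclosure P x y' -> y = y'.
Proof.
move=> PC H H'; apply/eqP; rewrite -subr_eq0 -normr_le0.
have := gclosure_comb (-1) H' H; rewrite !scaleN1r ![- _ + _]addrC subrr.
by move=> /(gclosure_Lip PC); rewrite normr0 mulr0.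
Qed.

Lemma gclosure_dom P x y : gclosure P x y -> closure (span (fst @` P)) x.
Proof.
move=> H; apply/closure_normP => e /H[w [Pw xw _]]; exists w.1 => //.
exact: (@span_linear _ _ _ fst).
Qed.

End Rel.

Lemma gclosure_ran (E F : normedModType R) (P : set (E * F)) x y :
  gclosure P x y -> closure (span (snd @` P)) y.
Proof.
move=> H; apply/closure_normP => e /H[w [Pw _ xw]]; exists w.2 => //.
exact: (@span_linear _ _ _ snd).
Qed.

Lemma cauchy_norm (F : completeNormedModType R) (u : nat -> F) :
  (forall e, 0 < e -> exists N, forall n, (N <= n)%N -> `|u N - u n| < e) ->
  exists y, forall e, 0 < e -> exists N, forall n, (N <= n)%N -> `|y - u n| < e.
Proof.
move=> H; have /cvg_ex[y /cvgrPdist_lt uy] : cvg (u @ \oo).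
  apply: cauchy_cvg; apply: cauchy_exP => e /H[N HN].
  by exists (u N), N => // n /= Nn; rewrite -ball_normE /=; exact: HN.
by exists y => e /uy[N _ HN]; exists N => n Nn; exact: HN.
Qed.

(** Take points of the graph whose first entries converge to [x]. The Lipschitz bound makes their
    second entries Cauchy, and [F] is complete. *)
Lemma gclosure_total (E : normedModType R) (F : completeNormedModType R) C
    (P : set (E * F)) x :
  Lip C P -> closure (span (fst @` P)) x -> exists y, gclosure P x y.
Proof.
move=> PC /closure_normP Px.
have H n : {w | span P w /\ `|x - w.1| < n.+1%:R^-1}.
  apply: cid; have [|_ /(@span_lift _ _ _ fst)[w Pw <-] xw] := Px n.+1%:R^-1.
    by rewrite invr_gt0.
  by exists w.
pose w n := sval (H n).
have wP n : span P (w n) := (svalP (H n)).1.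
have wx n : `|x - (w n).1| < n.+1%:R^-1 := (svalP (H n)).2.
have small e : 0 < e -> exists N, forall n, (N <= n)%N -> `|x - (w n).1| < e.
  move=> e0; have [N _ HN] := near_infty_natSinv_lt (PosNum e0).
  by exists N => n Nn; apply: lt_trans (wx n) (HN _ _).
have [|y wy] := @cauchy_norm F (snd \o w).
  move=> e e0; have C1 : 0 < `|C| + 1 by rewrite ltr_wpDl.
  have [N HN] := small (e / 2 / (`|C| + 1)) (divr_gt0 (divr_gt0 e0 (ltr0Sn _ 1) ) C1).
  exists N => n Nn /=.
  have /PC /= := spanB (wP N) (wP n).
  move=> /le_lt_trans; apply; rewrite (@le_lt_trans _ _ (`|C| * `|(w N).1 - (w n).1|))//.
    by rewrite ler_wpM2r// ler_norm.
  rewrite (@le_lt_trans _ _ ((`|C| + 1) * `|(w N).1 - (w n).1|))//.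
    by rewrite ler_wpM2r// lerDl.
  rewrite mulrC -ltr_pdivlMr// (le_lt_trans (ler_distD x _ _))//.
  by rewrite distrC [e]splitr !mulrDl ltrD// HN.
exists y => e e0; have [N HN] := small e e0; have [M HM] := wy e e0.
exists (w (maxn N M)); split => //; first by apply: HN; exact: leq_maxl.
by apply: HM; exact: leq_maxr.
Qed.

(** The graph closures of [P] and of [flip P] define the two maps, with default value 0 outside the
    closed spans. They are mutually inverse since a graph closure with a Lipschitz bound is
    single-valued. *)
Lemma biLip_isomorphic (E F : completeNormedModType R) C (P : set (E * F)) :
  biLip C P -> isomorphic (closed_lspan (fst @` P)) (closed_lspan (snd @` P)).
Proof.
have half (E' F' : completeNormedModType R) (Q : set (E' * F')) : biLip C Q ->
    exists f, (forall x, closure (span (fst @` Q)) x -> gclosure Q x (f x)) /\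
      {within closure (span (fst @` Q)), continuous f}.
  move=> CQ; have CQ' := biLip_Lip CQ.
  have H x : {y | closure (span (fst @` Q)) x -> gclosure Q x y}.
    apply: cid; case: (pselect (closure (span (fst @` Q)) x)) => [|N]; last by exists 0.
    by move=> /(gclosure_total CQ')[y]; exists y.
  pose f x := sval (H x); have fP x := svalP (H x).
  exists f; split => //; apply/subspace_continuousP => x Qx.
  apply/cvgrPdist_lt => e e0; have C1 : 0 < `|C| + 1 by rewrite ltr_wpDl.
  rewrite /within /=; apply/nbhs_ballP; exists (e / (`|C| + 1)); first exact: divr_gt0.
  move=> t; rewrite -ball_normE /= => xt Qt.
  have := gclosure_Lip CQ' (gclosure_comb (-1) (fP t Qt) (fP x Qx)).
  rewrite !scaleN1r ![- _ + _]addrC => /le_lt_trans; apply.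
  rewrite (@le_lt_trans _ _ ((`|C| + 1) * `|x - t|))//.
    by rewrite ler_wpM2r// (le_trans (ler_norm _))// lerDl.
  by rewrite mulrC -ltr_pdivlMr.
move=> CP; rewrite !closed_lspanE.
have [f [fP fc]] := half _ _ _ CP.
have [g [gP gc]] := half _ _ _ (biLip_flip CP).
have flipE : fst @` flip P = snd @` P.
  by apply/seteqP; split => _ [[x y] Pxy <-]; exists (y, x).
rewrite flipE in gP gc.
have gP' y : closure (span (snd @` P)) y -> gclosure P (g y) y.
  by move=> /gP H; apply/gclosure_flip.
have CP1 := biLip_Lip CP; have CP2 := biLip_Lip (biLip_flip CP).
exists f, g; split; split => //.
- by move=> x /fP /gclosure_ran.
- by move=> x /gP' /gclosure_dom.
- move=> x; rewrite inE => Px; have /gclosure_flip H := fP x Px.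
  exact: gclosure_fun CP2 (gP _ (gclosure_ran (fP x Px))) H.
- move=> y; rewrite inE => Py; have H := gP' y Py.
  exact: gclosure_fun CP1 (fP _ (gclosure_dom H)) H.
- move=> a x y Px Py; apply: gclosure_fun CP1 (fP _ _) (gclosure_comb a (fP x Px) (fP y Py)).
  exact: closure_span_comb.
Qed.

End Lip.

(** * Basic sequences *)

Section FiniteSpan.
Context {K : pzRingType} {U : lmodType K}.

Lemma span_rangeP (z : nat -> U) x : span (range z) x ->
  exists n (c : nat -> K), x = \sum_(i < n) c i *: z i.
Proof.
elim=> [|a _ _ [k _ <-] _ [n [c ->]]]; first by exists 0%N, (fun=> 0); rewrite big_ord0.
exists (maxn n k.+1), (fun i => a *+ (i == k) + c i *+ (i < n)%N).
under [RHS]eq_bigr do rewrite scalerDl.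
rewrite big_split /=; congr (_ + _).
  have kn : (k < maxn n k.+1)%N by rewrite leq_max leqnn orbT.
  rewrite (bigD1 (Ordinal kn))//= eqxx big1 ?addr0// => i.
  by rewrite -val_eqE /= => /negPf->; rewrite scale0r.
rewrite (big_ord_widen _ (fun i => c i *: z i) (leq_maxl n k.+1)) big_mkcond.
by apply: eq_bigr => i _; case: ltnP; rewrite ?mulr1n// mulr0n scale0r.
Qed.

Lemma span_ordP n (v : 'I_n -> U) x : span (range v) x ->
  exists c : 'I_n -> K, x = \sum_i c i *: v i.
Proof.
elim=> [|a _ _ [k _ <-] _ [c ->]].
  by exists (fun=> 0); rewrite big1// => i _; rewrite scale0r.
exists (fun i => a *+ (i == k) + c i).
under [RHS]eq_bigr do rewrite scalerDl.
rewrite big_split /=; congr (_ + _); rewrite (bigD1 k)//= eqxx big1 ?addr0// => i.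
by move=> /negPf->; rewrite scale0r.
Qed.

Lemma span_image_sub (I : Type) (z : I -> U) (P : set I) x :
  span (z @` P) x -> span (range z) x.
Proof. by apply: span_mono => _ [i _ <-]; exists i. Qed.

End FiniteSpan.

Lemma kernel_row (F : fieldType) (m n : nat) (M : 'M[F]_(m, n)) : (n < m)%N ->
  exists2 l : 'rV[F]_m, l != 0 & l *m M = 0.
Proof.
move=> nm; have : kermx M != 0.
  rewrite -mxrank_eq0 mxrank_ker subn_eq0 -ltnNge.
  exact: leq_ltn_trans (rank_leq_col M) nm.
by move=> /rowV0Pn[l /sub_kermxP lM l0]; exists l.
Qed.

(** The coefficient matrix has more rows than columns, so some nonzero row vector annihilates it
    from the left. *)
Lemma span_dependent (F : fieldType) (U : lmodType F) m n (v : 'I_n -> U)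
    (u : 'I_m -> U) : (n < m)%N -> (forall i, span (range v) (u i)) ->
  exists2 l : 'I_m -> F, (exists i, l i != 0) & \sum_i l i *: u i = 0.
Proof.
move=> nm uv; have H i : {c : 'I_n -> F | u i = \sum_j c j *: v j}.
  exact: cid (span_ordP (uv i)).
have [l l0 lM] := kernel_row (\matrix_(i < m, j < n) sval (H i) j) nm.
exists (fun i => l 0 i).
  by apply/existsP; rewrite -negb_forall; apply: contra l0 => /forallP l0;
    apply/eqP/rowP => i; rewrite mxE; apply/eqP; exact: l0.
under eq_bigr do rewrite (svalP (H _)) scaler_sumr.
rewrite exchange_big big1//= => j _; under eq_bigr do rewrite scalerA.
rewrite -scaler_suml; have /rowP/(_ j) := lM; rewrite !mxE => lMj.
suff -> : \sum_i l 0 i * sval (H i) j = 0 by rewrite scale0r.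
by rewrite -[RHS]lMj; apply: eq_bigr => i _; rewrite mxE.
Qed.

Section Basic.
Context {R : realType}.

(** The criterion by uniformly bounded initial projections, stated with spans so that no
    coefficients appear; [basic_schauder] recovers the basis. *)
Definition basic {E : normedModType R} (K : R) (b : nat -> E) :=
  (forall n, b n != 0) /\ forall n x t,
    span (b @` [set i | (i < n)%N]) x -> span (b @` [set i | (n <= i)%N]) t ->
    `|x| <= K * `|x + t|.

Definition eps (n : nat) : R := 2^-1 ^+ n.+1.

Lemma eps_gt0 n : 0 < eps n.
Proof. by rewrite /eps exprn_gt0// invr_gt0. Qed.

Lemma sum_eps n : \sum_(i < n) eps i <= 1.
Proof.
suff -> : \sum_(i < n) eps i = 1 - 2^-1 ^+ n.
  by rewrite gerBl exprn_ge0// invr_ge0.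
elim: n => [|n IH]; first by rewrite big_ord0 expr0 subrr.
rewrite big_ord_recr /= IH /eps exprS; set x := _ ^+ n; lra.
Qed.

Section BasicTheory.
Context {E : normedModType R} {K : R} {b : nat -> E}.
Hypothesis bK : basic K b.

Lemma basic_norm_gt0 n : 0 < `|b n|.
Proof. by rewrite normr_gt0 bK.1. Qed.

Lemma basic_ge1 : 1 <= K.
Proof.
have := bK.2 1%N (b 0%N) 0; rewrite addr0 -[X in X <= _]mul1r ler_pM2r ?basic_norm_gt0//.
by apply; [apply: span_incl; exists 0%N|exact: span0].
Qed.

Lemma basic_gt0 : 0 < K.
Proof. exact: lt_le_trans ltr01 basic_ge1. Qed.

Lemma basic_partial (c : nat -> R) m n : (m <= n)%N ->
  `|\sum_(i < m) c i *: b i| <= K * `|\sum_(i < n) c i *: b i|.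
Proof.
move=> mn; have nat_sum k : \sum_(i < k) c i *: b i = \sum_(0 <= i < k) c i *: b i.
  by rewrite big_mkord.
rewrite !nat_sum (big_cat_nat (n := m) (p := n))//.
apply: (bK.2 m).
  rewrite big_mkord; apply: span_sum => i _; apply: spanZ; apply: span_incl.
  by exists i => /=.
rewrite big_seq; apply: span_sum => i; rewrite mem_index_iota => /andP[mi _].
by apply: spanZ; apply: span_incl; exists i.
Qed.

Lemma basic_coef (c : nat -> R) n k : (k < n)%N ->
  `|c k| * `|b k| <= 2 * K * `|\sum_(i < n) c i *: b i|.
Proof.
move=> kn; rewrite -normrZ.
have -> : c k *: b k = \sum_(i < k.+1) c i *: b i - \sum_(i < k) c i *: b i.
  by rewrite big_ord_recr /= addrAC subrr add0r.
rewrite -mulrA mulr_natl mulr2n (le_trans (ler_normB _ _))// lerD//.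
  exact: basic_partial.
by apply: basic_partial; exact: ltnW.
Qed.

Lemma basic_eq0 (c : nat -> R) n : \sum_(i < n) c i *: b i = 0 ->
  forall k, (k < n)%N -> c k = 0.
Proof.
move=> c0 k kn; have := basic_coef c kn; rewrite c0 normr0 mulr0.
by rewrite pmulr_lle0 ?basic_norm_gt0// normr_le0 => /eqP.
Qed.

(** The small perturbation principle. By [basic_coef] the [i]-th error contributes at most
    [eps i * (|x| / (2 * C))], and the weights [eps] sum to at most 1. The total error is thus half
    of the lower bound [|x| / C], which costs a factor 2. *)
Lemma biLip_perturb (F : normedModType R) (C : R) (t s : nat -> F) : 1 <= C ->
  biLip C (range (fun i => (b i, t i))) ->
  (forall i, `|t i - s i| <= eps i / (4 * K * C) * `|b i|) ->
  biLip (2 * C) (range (fun i => (b i, s i))).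
Proof.
move=> C1 bt ts w /span_rangeP[n [c ->]].
have C0 : 0 < C by exact: lt_le_trans C1.
have K0 := basic_gt0.
have sum1 (G : normedModType R) (u : nat -> G) :
    (\sum_(i < n) c i *: (b i, u i)).1 = \sum_(i < n) c i *: b i.
  exact: (big_morph fst (id1 := 0) (op1 := +%R)).
have sum2 (G : normedModType R) (u : nat -> G) :
    (\sum_(i < n) c i *: (b i, u i)).2 = \sum_(i < n) c i *: u i.
  exact: (big_morph snd (id1 := 0) (op1 := +%R)).
rewrite sum1 sum2; set x := \sum_(i < n) c i *: b i.
have [|H1 H2] := bt (\sum_(i < n) c i *: (b i, t i)).
  by apply: span_sum => i _; apply/spanZ/span_incl; exists i.
move: H1 H2; rewrite sum1 sum2 -/x.
set T := \sum_(i < n) c i *: t i; set S := \sum_(i < n) c i *: s i.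
have TS : `|T - S| <= `|x| / (2 * C).
  rewrite /T /S -sumrB; under eq_bigr do rewrite -scalerBr.
  apply: le_trans (ler_norm_sum _ _ _) _.
  have H i : (i < n)%N -> `|c i *: (t i - s i)| <= eps i * (`|x| / (2 * C)).
    move=> lin; rewrite normrZ (le_trans (ler_wpM2l _ (ts i)))//.
    have -> : `|c i| * (eps i / (4 * K * C) * `|b i|) =
              eps i * ((`|c i| * `|b i|) / (4 * K * C)) by ring.
    rewrite ler_pM2l ?eps_gt0// ler_pdivrMr ?mulr_gt0//.
    apply: le_trans (basic_coef c lin) _; rewrite -/x.
    by rewrite le_eqVlt; apply/orP; left; apply/eqP; field; rewrite gt_eqF.
  apply: (@le_trans _ _ (\sum_(i < n) eps i * (`|x| / (2 * C)))).
    by apply: ler_sum => i _; exact: H.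
  rewrite -mulr_suml ler_piMl ?sum_eps// divr_ge0// mulr_ge0// ltW//.
have ST : `|S| <= `|T| + `|T - S|.
  have -> : S = T - (T - S) by rewrite subKr.
  by rewrite (le_trans (ler_normB _ _))// subKr.
have TS' : `|T| <= `|S| + `|T - S|.
  have {1}-> : T = S + (T - S) by rewrite addrC subrK.
  exact: ler_normD.
have D : `|x| / (2 * C) <= `|x| / 2.
  by rewrite ler_wpM2l// lef_pV2 ?posrE ?mulr_gt0// ler_peMr.
have E1 : C * (`|x| / (2 * C)) = `|x| / 2 by field; rewrite gt_eqF.
have x0 := normr_ge0 x.
move=> H1 H2; split; first by nra.
have := ler_wpM2l (ltW C0) (le_trans TS' (lerD (lexx _) TS)).
by rewrite mulrDr E1; lra.
Qed.

End BasicTheory.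
End Basic.

(** * Rational vectors in a Banach space *)

Section Eval.
Context {R : realType} {E : normedModType R}.
Variable e : nat -> E.

Definition ev (p : vec) : E := \sum_(i < size p) ratr p`_i *: e i.

Lemma evE n (p : vec) : (size p <= n)%N -> ev p = \sum_(i < n) ratr p`_i *: e i.
Proof.
move=> pn; rewrite /ev (big_ord_widen _ (fun i => ratr p`_i *: e i) pn) big_mkcond.
by apply: eq_bigr => i _; case: ltnP => // ?; rewrite nth_default// rmorph0 scale0r.
Qed.

Lemma ev0 : ev 0 = 0.
Proof. by rewrite /ev size_poly0 big_ord0. Qed.

Lemma ev_comb a (p q : vec) : ev (a *: p + q) = ratr a *: ev p + ev q.
Proof.
set n := maxn (size p) (size q).
rewrite (@evE n) ?(@evE n p) ?(@evE n q) ?leq_maxl ?leq_maxr//.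
  rewrite scaler_sumr -big_split /=; apply: eq_bigr => i _.
  by rewrite coefD coefZ rmorphD rmorphM scalerDl scalerA.
rewrite (leq_trans (size_polyD _ _))// geq_max leq_maxr andbT.
by rewrite (leq_trans (size_scale_leq _ _))// leq_maxl.
Qed.

Lemma ev_span S v : span S v -> span (ev @` S) (ev v).
Proof. by apply: (span_map (h := ratr)); [exact: ev0|exact: ev_comb]. Qed.

Definition ev2 (w : vec * vec) : E * E := (ev w.1, ev w.2).

Lemma ev2_span S w : span S w -> span (ev2 @` S) (ev2 w).
Proof.
apply: (span_map (h := ratr)); first by rewrite /ev2 /= ev0.
by move=> a [x x'] [y y']; rewrite /ev2 /= !ev_comb.
Qed.

Lemma ev_dense (S : set vec) x d : 0 < d -> span (ev @` S) x ->
  exists2 v, span S v & `|x - ev v| < d.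
Proof.
move=> d0 Sx; elim: Sx d d0 => [|a _ y [s Ss <-] _ IH] d d0.
  by exists 0; [exact: span0|rewrite ev0 subr0 normr0].
have d2 : 0 < d / 2 by exact: divr_gt0.
have s1 : 0 < `|ev s| + 1 by rewrite ltr_wpDl.
have [v Sv yv] := IH _ d2.
pose t := d / 2 / (`|ev s| + 1); have t0 : 0 < t by exact: divr_gt0.
have [|q] := @rat_in_itvoo R (a - t) (a + t); first by lra.
rewrite in_itv /= => /andP[q1 q2].
exists (q *: s + v); first exact: span_cons.
rewrite ev_comb opprD addrACA -scalerBl (le_lt_trans (ler_normD _ _))// normrZ.
rewrite [d in _ < d]splitr ler_ltD// (@le_trans _ _ (`|a - ratr q| * (`|ev s| + 1)))//.
  by rewrite ler_wpM2l// lerDl.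
by rewrite -ler_pdivlMr// -/t ler_norml; apply/andP; split; lra.
Qed.

Section EvBasic.
Variable K : R.
Hypothesis eK : basic K e.

Lemma ev_eq0 v : ev v = 0 -> v = 0.
Proof.
move=> v0; apply/polyP => i; rewrite coef0.
case: (ltnP i (size v)) => [iv|]; last exact: nth_default.
have /eqP := basic_eq0 eK (c := fun i => ratr v`_i) v0 iv.
by rewrite fmorph_eq0 => /eqP.
Qed.

Lemma span_ev_size (S : set vec) n x : (forall v, S v -> (size v <= n)%N) ->
  span (ev @` S) x -> span (e @` [set i | (i < n)%N]) x.
Proof.
move=> Sn; apply: span_trans => _ [v /Sn vn <-].
by apply: span_sum => i _; apply/spanZ/span_incl; exists i => //=; apply: leq_trans vn.
Qed.

Lemma span_ev_above (S : set vec) n x : (forall v, S v -> above n v) ->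
  span (ev @` S) x -> span (e @` [set i | (n <= i)%N]) x.
Proof.
move=> Sn; apply: span_trans => _ [v /Sn vn <-].
apply: span_sum => i _; case: (ltnP i n) => [/vn->|ni].
  by rewrite rmorph0 scale0r; exact: span0.
by apply/spanZ/span_incl; exists i.
Qed.

Lemma block_basic z : block z -> basic K (ev \o z).
Proof.
move=> zb; split=> [n|n x t].
  by apply: contra (zb n).1 => /eqP/ev_eq0->.
rewrite -!(image_comp z ev) => zx zt.
(* With no vector before the cut, [x] is 0; otherwise [e] is cut at the place where the support of
   [z n] ends. *)
case: n zx zt => [|n] zx zt.
  have -> : x = 0.
    by elim: zx => // a _ y [_ [i //]].
  by rewrite normr0 mulr_ge0// ltW// (basic_gt0 eK).
apply: (eK.2 (size (z n))).
  by apply: span_ev_size zx => _ [i /= i_n <-]; exact: block_size_le.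
by apply: span_ev_above zt => _ [i /= ni <-]; exact: block_lt.
Qed.

End EvBasic.
End Eval.

(** * Closed spans of basic sequences *)

Section BasicSpan.
Context {R : realType}.

Lemma closure_ev_dense (E : normedModType R) (e : nat -> E) (S : set vec) x d :
  0 < d -> closure (span (ev e @` S)) x -> exists2 v, span S v & `|x - ev e v| < d.
Proof.
move=> d0 /closure_normP Sx; have d2 : 0 < d / 2 by exact: divr_gt0.
have [y Sy xy] := Sx _ d2; have [v Sv yv] := ev_dense d2 Sy.
by exists v => //; rewrite (le_lt_trans (ler_distD y _ _))// [d]splitr ltrD.
Qed.

Lemma basic_infinite_dim (E : completeNormedModType R) K (b : nat -> E) (X : set E) :
  basic K b -> (forall n, X (b n)) -> infinite_dim X.
Proof.
move=> bK Xb [S [/finite_seqP[s ->] XS]].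
pose v (i : 'I_(size s)) := nth 0 s i.
have [i|l [i li]] := @span_dependent _ _ (size s).+1 _ v (fun i => b i) (ltnSn _).
  have := XS _ (Xb i); rewrite lspanE; apply: span_mono => x /= xs.
  by exists (Ordinal (etrans (index_mem x s) xs)) => //; rewrite /v /= nth_index.
pose c k := if insub k is Some j then l j else 0.
have cE (j : 'I_(size s).+1) : c j = l j by rewrite /c valK.
move=> l0; have : \sum_(j < (size s).+1) c j *: b j = 0.
  by rewrite -[RHS]l0; apply: eq_bigr => j _; rewrite cE.
by move=> /(basic_eq0 bK) c0; move: li; rewrite -cE c0 ?eqxx.
Qed.

Lemma infinite_dim_notin (E : completeNormedModType R) (X : set E) (s : seq E) :
  infinite_dim X -> exists2 x, X x & ~ span [set` s] x.
Proof.
move=> Xinf; apply: contrapT => H; apply: Xinf; exists [set` s].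
split; first exact: finite_seq.
by move=> x Xx; rewrite lspanE; apply: contrapT => Nx; apply: H; exists x.
Qed.

Section Coordinates.
Context {E : completeNormedModType R} {K : R} {b : nat -> E}.
Hypothesis bK : basic K b.

(** The [k]-th coordinate functional as a relation, so that [gclosure] extends it to the closed
    span. *)
Let unit_rel (k : nat) : set (E * R^o) := range (fun i => (b i, (i == k)%:R)).

Let unit_rel_fst k : fst @` unit_rel k = range b.
Proof.
apply/seteqP; split=> [_ [_ [i _ <-] <-]|_ [i _ <-]]; first by exists i.
by exists (b i, (i == k)%:R) => //; exists i.
Qed.

Let unit_rel_sum (k : nat) n (c : nat -> R) :
  \sum_(i < n) c i *: ((b i, (i == k :> nat)%:R) : E * R^o) =
    (\sum_(i < n) c i *: b i, if (k < n)%N then c k else 0).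
Proof.
elim: n => [|n IH]; first by rewrite !big_ord0.
rewrite !big_ord_recr /= IH; congr (_, _) => /=.
rewrite ltnS [(k <= n)%N]leq_eqVlt eq_sym; case: eqVneq => [->|nk] /=.
  by rewrite ltnn add0r [_ *: _]mulr1.
by rewrite scaler0 addr0.
Qed.

Let unit_rel_Lip k : Lip (2 * K / `|b k|) (unit_rel k).
Proof.
move=> w /span_rangeP[n [c ->]]; rewrite unit_rel_sum /=.
have bk := basic_norm_gt0 bK k; have K0 := basic_gt0 bK.
case: ifP => kn; last by rewrite normr0 mulr_ge0// divr_ge0// mulr_ge0// ltW.
by rewrite mulrAC ler_pdivlMr//; exact: basic_coef.
Qed.

(** The partial sum operators are bounded by [K] on finite combinations, hence on the closed span.
    Each finite combination is eventually fixed by them, so they converge to the identity. *)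
Lemma basic_schauder : schauder_basis (closed_lspan (range b)) b.
Proof.
have K0 := basic_gt0 bK.
split=> [n|x]; rewrite closed_lspanE.
  by apply: subset_closure; apply: span_incl; exists n.
pose X := closure (span (range b)) => Xx.
have H k y : {a : R^o | X y -> gclosure (unit_rel k) y a}.
  apply: cid; case: (pselect (X y)) => [Xy|N]; last by exists 0.
  have [|a Ha] := @gclosure_total R E R^o _ (unit_rel k) y (@unit_rel_Lip k).
    by rewrite unit_rel_fst.
  by exists a.
pose a y k : R := sval (H k y).
have aP k y (Xy : X y) : gclosure (unit_rel k) y (a y k : R^o) := svalP (H k y) Xy.
have aU k y (t : R^o) : gclosure (unit_rel k) y t -> a y k = t.
  move=> yt; refine (gclosure_fun (@unit_rel_Lip k) (aP k y _) yt).
  by have := gclosure_dom yt; rewrite unit_rel_fst.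
have a_sum n (c : nat -> R) k : a (\sum_(i < n) c i *: b i) k = if (k < n)%N then c k else 0.
  apply: aU.
  have := @gclosure_incl R E R^o (unit_rel k)
    (\sum_(i < n) c i *: ((b i, (i == k :> nat)%:R) : E * R^o)).
  rewrite unit_rel_sum; apply; rewrite -unit_rel_sum; apply: span_sum => i _.
  by apply/spanZ/span_incl; exists i.
have aB y z k : X y -> X z -> a (y - z) k = a y k - a z k.
  move=> Xy Xz; have := gclosure_comb (-1) (aP k z Xz) (aP k y Xy).
  by rewrite !scaleN1r ![- _ + _]addrC => /aU.
have a_bound y k : X y -> `|a y k| * `|b k| <= 2 * K * `|y|.
  move=> Xy; have := gclosure_Lip (@unit_rel_Lip k) (aP k y Xy).
  by rewrite mulrAC ler_pdivlMr// (basic_norm_gt0 bK).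
pose S m y := \sum_(i < m) a y i *: b i.
have S_bound m y : X y -> `|S m y| <= K * `|y|.
  move=> Xy; apply/ler_addgt0Pr => e e0.
  (* A crude bound of [S m] that grows with [m] suffices to carry the sharp bound [K] from
     combinations [s] to their limit [y]: the total error is at most [M * |y - s|]. *)
  pose M : R := K + 2 * K * m%:R; have M0 : 0 < M by rewrite ltr_wpDr// !mulr_ge0// ltW.
  have [_ /span_rangeP[n [c ->]]] := proj1 (closure_normP _ _) Xy (e / M) (divr_gt0 e0 M0).
  set s := \sum_(i < n) _ => ys.
  have Xs : X s.
    by apply/subset_closure/span_sum => i _; apply/spanZ/span_incl; exists i.
  have Xys : X (y - s) by rewrite addrC -scaleN1r; exact: closure_span_comb.
  have -> : S m y = S m s + S m (y - s).
    rewrite /S -big_split /=; apply: eq_bigr => i _; rewrite -scalerDl aB//.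
    by rewrite addrC subrK.
  have Ss : `|S m s| <= K * `|s|.
    pose d i := if (i < n)%N then c i else 0.
    have -> : S m s = \sum_(i < m) d i *: b i.
      by apply: eq_bigr => i _; rewrite a_sum.
    have -> : s = \sum_(i < maxn m n) d i *: b i.
      rewrite /s (big_ord_widen _ (fun i => c i *: b i) (leq_maxr m n)) [LHS]big_mkcond.
      by apply: eq_bigr => i _; rewrite /d; case: ifP => //; rewrite scale0r.
    by apply: (basic_partial bK); exact: leq_maxl.
  have Sys : `|S m (y - s)| <= 2 * K * m%:R * `|y - s|.
    rewrite (le_trans (ler_norm_sum _ _ _))//.
    apply: (@le_trans _ _ (\sum_(i < m) 2 * K * `|y - s|)).
      by apply: ler_sum => i _; rewrite normrZ a_bound.
    by rewrite sumr_const card_ord -[leLHS]mulr_natr [leLHS]mulrAC.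
  have sy : `|s| <= `|y| + `|y - s|.
    have {1}-> : s = y - (y - s) by rewrite subKr.
    exact: ler_normB.
  have : M * `|y - s| <= e by rewrite mulrC -ler_pdivlMr// ltW.
  move=> Me; apply: le_trans (ler_normD _ _) _; move: Me; rewrite /M mulrDl.
  have := ler_wpM2l (ltW K0) sy; rewrite mulrDr; lra.
have S_cvg : forall e, 0 < e -> exists N, forall m, (N <= m)%N -> `|x - S m x| < e.
  move=> e e0; have K1 : 0 < K + 1 by rewrite addr_gt0.
  have [_ /span_rangeP[n [c ->]]] :=
    proj1 (closure_normP _ _) Xx (e / (K + 1)) (divr_gt0 e0 K1).
  set s := \sum_(i < n) _ => xs; exists n => m nm.
  have Xs : X s.
    by apply/subset_closure/span_sum => i _; apply/spanZ/span_incl; exists i.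
  have Xxs : X (x - s) by rewrite addrC -scaleN1r; exact: closure_span_comb.
  have sE : S m s = s.
    transitivity (\sum_(i < m) (if (i < n)%N then c i else 0) *: b i).
      by apply: eq_bigr => i _; rewrite a_sum.
    rewrite /s (big_ord_widen _ (fun i => c i *: b i) nm) [RHS]big_mkcond.
    by apply: eq_bigr => i _; case: ifP => //; rewrite scale0r.
  have -> : x - S m x = (x - s) - S m (x - s).
    have -> : S m (x - s) = S m x - s.
      by rewrite -{2}sE -sumrB; apply: eq_bigr => i _; rewrite -scalerBl aB.
    by rewrite opprB addrA subrK.
  rewrite (le_lt_trans (ler_normB _ _))//.
  rewrite (@le_lt_trans _ _ ((K + 1) * `|x - s|))//; last by rewrite mulrC -ltr_pdivlMr.
  by rewrite mulrDl mul1r addrC lerD2r S_bound.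
exists (a x); split.
  apply/cvgrPdist_lt => e /S_cvg[N HN]; exists N => // m /= /HN.
  by rewrite /series /= big_mkord.
(* Uniqueness: partial sums of another expansion [c] have [k]-th coordinate [c k] as soon as they
   have more than [k] terms, and the coordinate of [x] is determined by approximation. *)
move=> c /cvgrPdist_lt cx; apply/funext => k; apply: aU => e e0.
have [N _ HN] := cx e e0.
exists (\sum_(i < maxn N k.+1) c i *: ((b i, (i == k :> nat)%:R) : E * R^o)); split.
- by apply: span_sum => i _; apply/spanZ/span_incl; exists i.
- rewrite unit_rel_sum /=; have := HN (maxn N k.+1) (leq_maxl _ _).
  by rewrite /series /= big_mkord.
- by rewrite unit_rel_sum /= leq_max leqnn orbT subrr normr0.
Qed.

End Coordinates.

Lemma basic_banach (E : completeNormedModType R) K (b : nat -> E) :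
  basic K b -> banach_subspace (closed_lspan (range b)).
Proof.
move=> bK; split; first exact: closed_lspan_subspace.
apply: basic_infinite_dim bK _ => n; rewrite closed_lspanE.
by apply/subset_closure/span_incl; exists n.
Qed.

End BasicSpan.

(** * Mazur's construction of basic sequences *)

Lemma seq_choice (T : Type) (g : seq T -> T) :
  exists u : nat -> T, forall n, u n = g (mkseq u n).
Proof.
pose fix L n := if n is n'.+1 then rcons (L n') (g (L n')) else [::].
exists (fun n => g (L n)) => n; congr g.
by elim: n => //= n IH; rewrite mkseqS -IH.
Qed.

Lemma mkseq_set (T : eqType) (u : nat -> T) n :
  [set` mkseq u n] = u @` [set i | (i < n)%N].
Proof.
apply/seteqP; split=> [x /= /mapP[i]|_ [i /= lin <-]].
  by rewrite mem_iota add0n => /andP[_ lin] ->; exists i.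
by apply: map_f; rewrite mem_iota add0n.
Qed.

Section Mazur.
Context {R : realType} {E : completeNormedModType R}.
Implicit Types (P Q : set (E * R^o)) (X : set E).

(** A partial linear functional of norm at most 1, as a relation; the one-sided bound gives the
    absolute one because spans are closed under negation. *)
Definition dominated P := forall w, span P w -> w.2 <= `|w.1|.

(** Hahn-Banach for one vector: each [w.2 - |w.1 - v|] is at most each [|w.1 + v| - w.2], and the
    supremum of the former serves as the value at [v]. Rescaling reduces other multiples of [v] to
    these two bounds. *)
Lemma dominated_ext P v : dominated P ->
  exists c : R^o, dominated (P `|` [set (v, c)]).
Proof.
move=> dP.
pose S : set R := [set w.2 - `|w.1 - v| | w in span P].
have Sub w : span P w -> ubound S (`|w.1 + v| - w.2).
  move=> Pw _ [u Pu <-]; rewrite lerBlDr addrAC lerBrDr.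
  apply: le_trans (dP _ (spanD Pu Pw)) _.
  have -> : (u + w).1 = (w.1 + v) + (u.1 - v) by rewrite /= addrACA subrr addr0 addrC.
  exact: ler_normD.
have S0 : S !=set0 by exists (0 - `|0 - v|), 0 => //; exact: span0.
have hS : has_sup S by split => //; exists (`|0 + v| - 0); exact: (Sub 0 (span0 _)).
exists (sup S) => w /spanU[u [q [Pu Sq ->]]].
have [a ->] : exists a : R, q = a *: ((v, sup S) : E * R^o).
  elim: Sq => [|b _ _ -> _ [a ->]]; first by exists 0; rewrite scale0r.
  by exists (b + a); rewrite scalerDl.
have low p : span P p -> p.2 - `|p.1 - v| <= sup S.
  by move=> Pp; apply: ub_le_sup; [exact: hS.2|exists p].
have upp p : span P p -> sup S <= `|p.1 + v| - p.2.
  by move=> Pp; apply: ge_sup => //; exact: Sub.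
rewrite /=; have -> : a *: (sup S : R^o) = a * sup S by [].
have [a0|a0|->] := ltgtP a 0; last by rewrite mul0r !scale0r !addr0; exact: dP.
- have na : 0 < - a by rewrite oppr_gt0.
  have := low _ (spanZ (- a)^-1 Pu); rewrite /=.
  have -> : `|(- a)^-1 *: u.1 - v| = (- a)^-1 * `|u.1 + a *: v|.
    rewrite -{2}[(- a)^-1]gtr0_norm ?invr_gt0// -normrZ scalerDr scalerA.
    by rewrite invrN mulNr mulVf ?lt_eqF// scaleN1r.
  have -> : (- a)^-1 *: u.2 = (- a)^-1 * u.2 by [].
  by rewrite -mulrBr mulrC ler_pdivrMr// mulrN; set x := `|_|; lra.
- have := upp _ (spanZ a^-1 Pu); rewrite /=.
  have -> : `|a^-1 *: u.1 + v| = a^-1 * `|u.1 + a *: v|.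
    rewrite -{2}[a^-1]gtr0_norm ?invr_gt0// -normrZ scalerDr scalerA.
    by rewrite mulVf ?gt_eqF// scale1r.
  have -> : a^-1 *: u.2 = a^-1 * u.2 by [].
  by rewrite -mulrBr mulrC ler_pdivlMr// mulrC; set x := `|_|; lra.
Qed.

(** Start from the functional on the line of [y] and extend it by one vector at a time; only the
    finitely many vectors of [vs] are ever evaluated. *)
Lemma norming y (vs : seq E) : exists P, [/\ dominated P, P (y, `|y|) &
  forall v, v \in vs -> exists c, P (v, c)].
Proof.
elim: vs => [|v vs [P [dP Py Pvs]]].
  exists [set (y, `|y| : R^o)]; split => // w Sw.
  have [a ->] : exists a : R, w = a *: ((y, `|y|) : E * R^o).
    elim: Sw => [|b _ _ -> _ [a ->]]; first by exists 0; rewrite scale0r.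
    by exists (b + a); rewrite scalerDl.
  by rewrite /= normrZ; apply: ler_wpM2r => //; exact: ler_norm.
have [c dPc] := dominated_ext v dP.
exists (P `|` [set (v, c)]); split => //; first by left.
move=> w; rewrite inE => /predU1P[->|/Pvs[d Pd]]; first by exists c; right.
by exists d; left.
Qed.

Lemma real_net (B d : R) : 0 < d ->
  exists s : seq R, forall c, `|c| <= B -> exists2 t, t \in s & `|c - t| < d.
Proof.
move=> d0; exists [seq k%:R * d - B | k <- iota 0 (Num.truncn (2 * B / d)).+1] => c.
rewrite ler_norml => /andP[Bc cB].
have cB0 : 0 <= (c + B) / d by rewrite divr_ge0 ?(ltW d0)//; lra.
have /andP[k1 k2] := truncn_itv cB0.
exists ((Num.truncn ((c + B) / d))%:R * d - B).
  apply/mapP; exists (Num.truncn ((c + B) / d)) => //.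
  rewrite mem_iota add0n ltnS; apply: le_truncn.
  by rewrite ler_pM2r ?invr_gt0//; lra.
move: k1 k2; set k := Num.truncn _.
rewrite ler_pdivlMr// ltr_pdivrMr// -natr1 mulrDl mul1r => k1 k2.
by rewrite ltr_norml; apply/andP; split; lra.
Qed.

(** Explicit finite nets take the place of compactness of a bounded set of coefficients. *)
Lemma comb_net (B d : R) (x : nat -> E) n : 0 < d ->
  exists s : seq E, forall c : nat -> R, (forall i, (i < n)%N -> `|c i| <= B) ->
    exists2 y, y \in s & `|\sum_(i < n) c i *: x i - y| < d.
Proof.
elim: n d => [|n IH] d d0.
  by exists [:: 0] => c _; exists 0; rewrite ?mem_head// big_ord0 subrr normr0.
have d2 : 0 < d / 2 by exact: divr_gt0.
have x1 : 0 < `|x n| + 1 by rewrite ltr_wpDl.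
have [s sP] := IH _ d2; have [r rP] := real_net B (divr_gt0 d2 x1).
exists [seq y + t *: x n | y <- s, t <- r] => c cB.
have [|y ys yc] := sP c; first by move=> i lin; apply: cB; exact: ltnW.
have [t tr tc] := rP _ (cB n (ltnSn n)).
exists (y + t *: x n); first by apply/allpairsP; exists (y, t).
rewrite big_ord_recr /= opprD addrACA -scalerBl (le_lt_trans (ler_normD _ _))//.
rewrite [d in _ < d]splitr ltr_leD// normrZ (@le_trans _ _ (`|c n - t| * (`|x n| + 1)))//.
  by rewrite ler_wpM2l// lerDl.
by rewrite -ler_pdivlMr// ltW.
Qed.

Lemma independent_seq X : infinite_dim X -> exists v : nat -> E,
  (forall n, X (v n)) /\ forall n (c : nat -> R), \sum_(i < n) c i *: v i = 0 ->
    forall i, (i < n)%N -> c i = 0.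
Proof.
move=> Xinf.
have H (s : seq E) : {x | X x /\ ~ span [set` s] x}.
  by apply: cid; have [x] := infinite_dim_notin s Xinf; exists x.
have [v vE] := seq_choice (fun s => sval (H s)).
have vP n : X (v n) /\ ~ span (v @` [set i | (i < n)%N]) (v n).
  by have := svalP (H (mkseq v n)); rewrite -vE mkseq_set.
exists v; split=> [n|n c]; first exact: (vP n).1.
elim: n => // n IH; rewrite big_ord_recr /= => c0.
have cn : c n = 0.
  apply: contrapT => /eqP cn; apply: (vP n).2.
  have -> : v n = - (c n)^-1 *: (\sum_(i < n) c i *: v i).
    rewrite scaleNr -scalerN; move/eqP: c0; rewrite addr_eq0 => /eqP ->.
    by rewrite opprK scalerA mulVf// scale1r.
  apply: spanZ; apply: span_sum => i _; apply/spanZ/span_incl.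
  by exists i => /=.
move: c0; rewrite cn scale0r addr0 => /IH {}IH i; rewrite ltnS leq_eqVlt.
by move=> /predU1P[->//|/IH].
Qed.

(** This bound lets [comb_net] cover the unit sphere of the span; [mazur] carries it along its
    induction. *)
Definition coef_bounded (s : seq E) := exists B : R, forall y, span [set` s] y ->
  exists c : nat -> R, y = \sum_(i < size s) c i *: nth 0 s i /\
    forall i, (i < size s)%N -> `|c i| <= B * `|y|.

(** Choose a finite net for the unit sphere of the span of [s] and a norming functional for each of
    its points. These [m] functionals have a common nonzero zero among the combinations of [m.+1]
    independent vectors of [X]; adding multiples of it cannot shorten a net point. *)
Lemma mazur_step X s k : submod_closed [in X] -> infinite_dim X -> 1 < k ->
  coef_bounded s -> exists x, [/\ X x, `|x| = 1 &
    forall y a, span [set` s] y -> `|y| <= k * `|y + a *: x|].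
Proof.
move=> [_ Xlin] Xinf k1 [B sB]; have k0 : 0 < k by exact: lt_trans k1.
(* Passing from a unit vector to a net point and back loses less than [d] twice, and
   [1 - 2 * d = k^-1]. *)
pose d := (1 - k^-1) / 2.
have d0 : 0 < d by rewrite divr_gt0// subr_gt0 invf_lt1.
have [net netP] := comb_net B (nth 0 s) (size s) d0.
have [v [Xv vI]] := independent_seq Xinf.
set m := size net.
have H y : {P | [/\ dominated P, P (y, `|y| : R^o) &
    forall w, w \in mkseq v m.+1 -> exists c, P (w, c)]}.
  exact: cid (norming y _).
have Hc (j : 'I_m) (i : 'I_m.+1) : {c : R^o | sval (H (nth 0 net j)) (v i, c)}.
  apply: cid; have [_ _] := svalP (H (nth 0 net j)); apply.
  by apply/mapP; exists (i : nat) => //; rewrite mem_iota add0n ltn_ord.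
have [l l0 lM] := kernel_row (\matrix_(i < m.+1, j < m) (sval (Hc j i) : R)) (ltnSn m).
pose c i := if insub i is Some j then l 0 j else 0.
have cE (i : 'I_m.+1) : c i = l 0 i by rewrite /c valK.
set x := \sum_(i < m.+1) c i *: v i.
have x0 : x != 0.
  apply: contra l0 => /eqP/vI c0; apply/eqP/rowP => i.
  by rewrite mxE -cE c0.
have Xx : X x.
  have Xcomb a y z : X y -> X z -> X (a *: y + z).
    by move=> Xy Xz; have := Xlin a y z; rewrite !inE; exact.
  have X0 : X 0 by have := Xcomb (-1) _ _ (Xv 0%N) (Xv 0%N); rewrite scaleN1r addNr.
  rewrite /x; elim/big_ind: _ => [//|y z Xy Xz|i _].
    by rewrite -[y]scale1r; exact: Xcomb.
  by rewrite -[_ *: _]addr0; exact: Xcomb.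
have xnet y a : y \in net -> `|y| <= `|y + a *: x|.
  move=> ynet; have jm : (index y net < m)%N by rewrite index_mem.
  pose j := Ordinal jm; have yj : nth 0 net j = y by rewrite nth_index.
  have [dP Py _] := svalP (H (nth 0 net j)).
  have Px : span (sval (H (nth 0 net j))) (x, 0 : R^o).
    have -> : (x, 0 : R^o) = \sum_(i < m.+1) c i *: ((v i, sval (Hc j i)) : E * R^o).
      apply: injective_projections => /=.
        by rewrite (big_morph fst (id1 := 0) (op1 := +%R)).
      rewrite (big_morph snd (id1 := 0) (op1 := +%R))//=.
      move/rowP/(_ j): lM; rewrite !mxE => lMj; rewrite -[LHS]lMj.
      by apply: eq_bigr => i _; rewrite mxE cE.
    apply: span_sum => i _; apply/spanZ/span_incl.
    exact: svalP (Hc j i).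
  have /dP /= := spanD (span_incl Py) (spanZ a Px).
  by rewrite scaler0 addr0 yj.
have key y a : span [set` s] y -> `|y| = 1 -> k^-1 <= `|y + a *: x|.
  move=> sy y1; have [e [ye eB]] := sB y sy.
  have [|z znet yz] := netP e; first by move=> i /eB; rewrite y1 mulr1.
  rewrite -ye in yz; have := xnet z a znet.
  have : `|z + a *: x| <= `|y + a *: x| + `|y - z|.
    have -> : z + a *: x = (y + a *: x) - (y - z) by rewrite opprB [RHS]addrC addrA subrK.
    exact: ler_normB.
  have : `|y| <= `|z| + `|y - z|.
    by rewrite -{1}[y](subrK z) addrC ler_normD.
  rewrite y1; move: yz; rewrite /d.
  by set p := `|y - z|; set q := `|z + _|; set r := `|_ + _|; set t := `|z|; lra.
have nx : 0 < `|x| by rewrite normr_gt0.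
exists (`|x|^-1 *: x); split.
- have := Xlin (`|x|^-1) x 0; rewrite !inE addr0; apply => //.
  have := Xlin (-1) x x; rewrite !inE scaleN1r addNr; exact.
- by rewrite normrZ ger0_norm ?invr_ge0// mulVf// gt_eqF.
move=> y a sy; have [->|y0] := eqVneq y 0.
  by rewrite normr0 mulr_ge0// ltW.
have ny : 0 < `|y| by rewrite normr_gt0.
have := key (`|y|^-1 *: y) (`|y|^-1 * a / `|x|) (spanZ _ sy).
rewrite normrZ ger0_norm ?invr_ge0// mulVf ?gt_eqF// => /(_ erefl).
rewrite -!scalerA -scalerDr normrZ ger0_norm ?invr_ge0//.
set N := `|_ + _|.
by rewrite [_ * N]mulrC ler_pdivlMr// mulrC ler_pdivrMr// mulrC.
Qed.

Lemma mazur X : closed_subspace X -> infinite_dim X ->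
  exists x : nat -> E, [/\ basic 2 x, forall n, X (x n) & forall n, `|x n| = 1].
Proof.
move=> [Xlin _] Xinf.
(* These numbers increase from 1 towards 2. The [n]-th step uses the constant [d n.+1 / d n], so the
   product of consecutive constants telescopes and stays below 2. *)
pose d n : R := 2 - 2^-1 ^+ n.
have p0 n : 0 < 2^-1 ^+ n :> R by rewrite exprn_gt0// invr_gt0.
have p1 n : 2^-1 ^+ n <= 1 :> R by rewrite exprn_ile1// ?invr_ge0// invf_le1// ler1n.
have d1 n : 1 <= d n by have := p1 n; rewrite /d; lra.
have d2 n : d n <= 2 by have := p0 n; rewrite /d; lra.
have dS n : d n < d n.+1 by have := p0 n; rewrite /d exprS; lra.
have d0 n : 0 < d n by exact: lt_le_trans (d1 n).
have H s : {x | coef_bounded s -> [/\ X x, `|x| = 1 & forall y a,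
    span [set` s] y -> `|y| <= d (size s).+1 / d (size s) * `|y + a *: x|]}.
  apply: cid; case: (pselect (coef_bounded s)) => [sB|N]; last by exists 0.
  have [|x xP] := mazur_step Xlin Xinf _ sB (k := d (size s).+1 / d (size s)); last by exists x.
  by rewrite ltr_pdivlMr// mul1r.
have [x xE] := seq_choice (fun s => sval (H s)).
have xP n : coef_bounded (mkseq x n) -> [/\ X (x n), `|x n| = 1 & forall y a,
    span (x @` [set i | (i < n)%N]) y -> d n * `|y| <= d n.+1 * `|y + a *: x n|].
  move=> sB; have [] := svalP (H (mkseq x n)) sB; rewrite -xE size_mkseq mkseq_set.
  move=> Xx x1 xs; split => // y a /(xs _ a).
  by rewrite mulrAC ler_pdivlMr// mulrC.
have xB n : coef_bounded (mkseq x n).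
  elim: n => [|n IH].
    exists 0 => y; rewrite mkseq_set => Sy; exists (fun=> 0); split => //.
    rewrite big_ord0; elim: Sy => // a _ z [i //].
  have [_ x1 xs] := xP n IH; have [B sB] := IH.
  (* For [y = z + a *: x n] one has [|z| <= 2 * |y|], so the old coefficients are at most
     [2 * |B| * |y|], and [|a| = |y - z|] is at most [3 * |y|]. *)
  exists (2 * `|B| + 3) => y; rewrite mkseq_set size_mkseq => Sy.
  have [z [a [Sz yE]]] : exists z a, span (x @` [set i | (i < n)%N]) z /\ y = z + a *: x n.
    elim: Sy => [|b _ w [i /= lin <-] _ [z [a [Sz ->]]]].
      by exists 0, 0; rewrite scale0r addr0; split => //; exact: span0.
    move: lin; rewrite ltnS leq_eqVlt => /predU1P[->|lin].
      by exists z, (b + a); rewrite scalerDl addrCA.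
    exists (b *: x i + z), a; rewrite addrA; split => //.
    by apply: span_cons => //; exists i.
  have [|c [zE cB]] := sB z; first by rewrite mkseq_set.
  rewrite size_mkseq in zE cB.
  have zy : `|z| <= 2 * `|y|.
    have := xs z a Sz; rewrite -yE => dzy.
    apply: le_trans (_ : d n * `|z| <= _); first by rewrite ler_peMl.
    by apply: le_trans dzy _; rewrite ler_wpM2r.
  have ay : `|a| <= 3 * `|y|.
    have : `|a| = `|y - z| by rewrite yE addrC addKr normrZ x1 mulr1.
    have := ler_normB y z; lra.
  exists (fun i => if (i < n)%N then c i else a); split.
    rewrite big_ord_recr /= ltnn nth_mkseq// yE zE; congr (_ + _).
    by apply: eq_bigr => i _; rewrite ltn_ord !nth_mkseq// ltnW// ltnS.
  move=> i /= _; case: ltnP => [lin|ni].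
    apply: le_trans (cB i lin) _.
    apply: (@le_trans _ _ (`|B| * (2 * `|y|))); last first.
      by rewrite [leRHS]mulrDl [leLHS]mulrCA [leLHS]mulrA lerDl mulr_ge0.
    apply: le_trans (_ : `|B| * `|z| <= _); last by rewrite ler_wpM2l.
    by rewrite ler_wpM2r// ler_norm.
  by apply: le_trans ay _; rewrite [leRHS]mulrDl lerDr; do !apply: mulr_ge0 => //.
have xP' n := xP n (xB n).
exists x; split => [|n|n]; try by have [] := xP' n.
split=> [n|n y t Sy St].
  by rewrite -normr_eq0; have [_ -> _] := xP' n; rewrite oner_eq0.
have : exists2 N, (n <= N)%N & span (x @` [set i | (n <= i < N)%N]) t.
  elim: St => [|a _ w [i /= ni <-] _ [N nN Nw]]; first by exists n => //; exact: span0.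
  exists (maxn N i.+1); first by rewrite leq_max nN.
  apply: span_cons; first by exists i => //=; rewrite ni leq_max leqnn orbT.
  apply: span_mono Nw => _ [j /= /andP[nj jN] <-]; exists j => //=.
  by rewrite nj leq_max jN.
move=> [N nN Nt].
suff H' : d n * `|y| <= d N * `|y + t|.
  apply: le_trans (_ : d n * `|y| <= _); first by rewrite ler_peMl.
  by apply: le_trans H' _; rewrite ler_wpM2r.
elim: N nN t Nt {St} => [|N IH].
  rewrite leqn0 => /eqP-> t Nt; suff -> : t = 0 by rewrite addr0.
  by elim: Nt => // a z w [i //].
rewrite leq_eqVlt => /predU1P[<-|nN] t Nt.
  suff -> : t = 0 by rewrite addr0.
  by elim: Nt => // a z w [i /= /andP[ni]]; rewrite ltnNge ni.
have [u [a [Su tE]]] : exists u a,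
    span (x @` [set i | (n <= i < N)%N]) u /\ t = u + a *: x N.
  elim: Nt => [|b _ w [i /= /andP[ni]] + <- _ [z [a [Sz ->]]]].
    by exists 0, 0; rewrite scale0r addr0; split => //; exact: span0.
  rewrite ltnS leq_eqVlt => /predU1P[->|iN].
    by exists z, (b + a); rewrite scalerDl addrCA.
  exists (b *: x i + z), a; rewrite addrA; split => //.
  by apply: span_cons => //; exists i => //=; rewrite ni.
apply: le_trans (IH nN u Su) _; rewrite tE addrA.
have [_ _] := xP' N; apply.
apply: spanD.
  by apply: span_mono Sy => _ [i /= lin <-]; exists i => //=; exact: leq_trans lin nN.
by apply: span_mono Su => _ [i /= /andP[_ iN] <-]; exists i.
Qed.

End Mazur.

Section PairSums.
Context {R : realType} {E F : normedModType R}.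

Lemma pair_sum n (c : nat -> R) (u : nat -> E) (v : nat -> F) :
  \sum_(i < n) c i *: (u i, v i) = (\sum_(i < n) c i *: u i, \sum_(i < n) c i *: v i).
Proof. by elim: n => [|n IH]; rewrite ?big_ord0// !big_ord_recr /= IH. Qed.

Lemma biLip_rangeP C (u : nat -> E) (v : nat -> F) :
  biLip C (range (fun i => (u i, v i))) <-> forall n (c : nat -> R),
    `|\sum_(i < n) c i *: v i| <= C * `|\sum_(i < n) c i *: u i| /\
    `|\sum_(i < n) c i *: u i| <= C * `|\sum_(i < n) c i *: v i|.
Proof.
split=> [H n c|H w /span_rangeP[n [c ->]]]; last by rewrite pair_sum; exact: H.
have := H (\sum_(i < n) c i *: (u i, v i)); rewrite pair_sum; apply.
by rewrite -pair_sum; apply: span_sum => i _; apply/spanZ/span_incl; exists i.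
Qed.

End PairSums.

Lemma biLip_comp (R : realType) (E F G : normedModType R) (C C' : R) (u : nat -> E)
    (v : nat -> F) (w : nat -> G) : 0 <= C -> 0 <= C' ->
  biLip C (range (fun i => (u i, v i))) -> biLip C' (range (fun i => (v i, w i))) ->
  biLip (C * C') (range (fun i => (u i, w i))).
Proof.
move=> C0 C'0 /biLip_rangeP uv /biLip_rangeP vw; apply/biLip_rangeP => n c.
have [uv1 uv2] := uv n c; have [vw1 vw2] := vw n c; split.
  by apply: le_trans vw1 _; rewrite [C * C']mulrC -mulrA ler_wpM2l.
by apply: le_trans uv2 _; rewrite -mulrA ler_wpM2l.
Qed.

(** * Gliding humps *)

Section Hump.
Context {R : realType} {E : completeNormedModType R} {K : R} {e : nat -> E}.
Hypothesis eK : basic K e.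

(** Take [n.+1] terms of a normalised basic sequence in [X]. Up to small errors their heads lie in
    the span of the first [n] vectors of [z], so some nontrivial combination cancels the heads; once
    normalised it is close to a tail vector, which is then made rational. *)
Lemma hump (z : nat -> vec) (X : set E) (d : R) n : block z -> closed_subspace X ->
  infinite_dim X -> X `<=` closed_lspan (range (ev e \o z)) -> 0 < d ->
  exists w : E * vec, [/\ X w.1, `|w.1| = 1, span (z @` [set i | (n <= i)%N]) w.2 &
    `|w.1 - ev e w.2| < d].
Proof.
move=> zb Xc Xinf Xz d0; set b := ev e \o z in Xz *.
have [x [x2 Xx x1]] := mazur Xc Xinf.
have d2 : 0 < d / 2 by exact: divr_gt0.
(* There are [n.+1] errors, each with a coefficient of size at most 4, namely twice the basis
   constant 2 of [x]. The other half of [d] pays for the rational approximation. *)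
pose dl := d / 2 / (4 * n.+1%:R).
have dl0 : 0 < dl by rewrite divr_gt0// mulr_gt0.
have H i : {ht : E * E | [/\ span (b @` [set i | (i < n)%N]) ht.1,
    span (b @` [set i | (n <= i)%N]) ht.2 & `|x i - (ht.1 + ht.2)| < dl]}.
  apply: cid; have := Xz _ (Xx i); rewrite closed_lspanE => /closure_normP/(_ _ dl0)[s bs xs].
  have : span ((b @` [set i | (i < n)%N]) `|` (b @` [set i | (n <= i)%N])) s.
    by apply: span_mono bs => _ [j _ <-]; case: (ltnP j n) => nj; [left|right]; exists j.
  by move=> /spanU[h [t [bh bt sE]]]; exists (h, t); split => //=; rewrite -sE.
have [i|l [i li] hl] := @span_dependent _ _ n.+1 _ (fun j : 'I_n => b j)
    (fun i => (sval (H i)).1) (ltnSn n).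
  have [+ _ _] := svalP (H i); apply: span_mono => _ [j /= jn <-].
  by exists (Ordinal jn).
pose lam k := if insub k is Some j then l j else 0.
have lamE (j : 'I_n.+1) : lam j = l j by rewrite /lam valK.
have xl0 : 0 < `|\sum_(j < n.+1) lam j *: x j|.
  rewrite normr_gt0; apply: contraNneq li => /(basic_eq0 x2) lam0.
  by rewrite -lamE lam0.
set N := `|_| in xl0; pose c k := N^-1 * lam k.
have cE (u : nat -> E) : \sum_(j < n.+1) c j *: u j = N^-1 *: \sum_(j < n.+1) lam j *: u j.
  by rewrite scaler_sumr; apply: eq_bigr => j _; rewrite scalerA.
have c1 : `|\sum_(j < n.+1) c j *: x j| = 1.
  by rewrite cE normrZ normfV /N normr_id mulVf// gt_eqF.
have c4 k : (k < n.+1)%N -> `|c k| <= 4.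
  move=> kn; have := basic_coef x2 c kn; rewrite c1 x1; lra.
pose t := \sum_(j < n.+1) c j *: (sval (H j)).2.
have zt : span (ev e @` (z @` [set i | (n <= i)%N])) t.
  rewrite image_comp; apply: span_sum => j _; apply: spanZ.
  by have [] := svalP (H j).
have [v zv tv] := ev_dense d2 zt.
exists (\sum_(j < n.+1) c j *: x j, v); split => //=.
  rewrite big_seq; elim/big_ind: _ => [|y y' Xy Xy'|j _].
  - by have := Xc.1.1; rewrite inE.
  - by have := Xc.1.2 1 y y'; rewrite !inE scale1r; exact.
  - have := Xc.1.2 (c j) (x j) 0; rewrite !inE addr0; apply => //.
    by have := Xc.1.1; rewrite inE.
rewrite (le_lt_trans (ler_distD t _ _))// [d]splitr ler_ltD//.
have -> : \sum_(j < n.+1) c j *: x j - t =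
    \sum_(j < n.+1) c j *: (x j - ((sval (H j)).1 + (sval (H j)).2)).
  under [RHS]eq_bigr do rewrite opprD addrCA scalerDr scalerN.
  rewrite big_split /= sumrN.
  rewrite (_ : \sum_(j < n.+1) c j *: (sval (H j)).1 = 0) ?oppr0 ?add0r.
    by under [RHS]eq_bigr do rewrite scalerBr; rewrite sumrB.
  rewrite (cE (fun j => (sval (H j)).1)) (eq_bigr (fun j : 'I_n.+1 => l j *: (sval (H j)).1)).
    by rewrite hl scaler0.
  by move=> j _; rewrite lamE.
apply: le_trans (ler_norm_sum _ _ _) _.
apply: (@le_trans _ _ (\sum_(j < n.+1) 4 * dl)).
  apply: ler_sum => j _; rewrite normrZ ler_pM// ?c4//.
  by have [_ _ /ltW] := svalP (H j).
rewrite sumr_const card_ord -mulr_natr /dl.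
by rewrite le_eqVlt; apply/orP; left; apply/eqP; field; rewrite addrC natr1 pnatr_eq0.
Qed.

Lemma hump_seq (z : nat -> vec) (X : set E) : block z -> closed_subspace X ->
  infinite_dim X -> X `<=` closed_lspan (range (ev e \o z)) ->
  exists (x : nat -> E) (y : nat -> vec), [/\ forall n, X (x n), block y,
    bspan y `<=` bspan z & biLip 2 (range (fun n => (ev e (y n), x n)))].
Proof.
move=> zb Xc Xinf Xz; have K0 := basic_gt0 eK; have K1 := basic_ge1 eK.
(* As [d n <= 2^-1], the codes keep norm at least [2^-1]. Hence [d n] is at most [eps n / (4 * K)]
   times that norm, as [biLip_perturb] requires for [C = 1]. *)
pose d n : R := eps n / (8 * K).
have d0 n : 0 < d n by rewrite divr_gt0 ?eps_gt0// mulr_gt0.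
have dh n : d n <= 2^-1.
  rewrite ler_pdivrMr ?mulr_gt0//; apply: le_trans (_ : 1 <= _); last by lra.
  by rewrite exprn_ile1// ?invr_ge0// invf_le1// ler1n.
(* The next code uses only vectors of [z] whose index is at least the size of the previous code,
   hence lies beyond its support; the default 0 starts the construction. *)
have H (s : seq (E * vec)) : {w : E * vec | [/\ X w.1, `|w.1| = 1,
    span (z @` [set i | (size (last (0%R : E, 0%R : vec) s).2 <= i)%N]) w.2 &
    `|w.1 - ev e w.2| < d (size s)]}.
  by apply: cid; exact: hump.
have [w wE] := seq_choice (fun s => sval (H s)).
have wP n : [/\ X (w n).1, `|(w n).1| = 1,
    span (z @` [set i | (size (last (0%R : E, 0%R : vec) (mkseq w n)).2 <= i)%N]) (w n).2 &
    `|(w n).1 - ev e (w n).2| < d n].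
  by have := svalP (H (mkseq w n)); rewrite -wE size_mkseq.
pose x n := (w n).1; pose y n := (w n).2.
have xd n : `|x n - ev e (y n)| < d n by have [] := wP n.
have y_ge n : 2^-1 <= `|ev e (y n)|.
  have x1 : `|x n| = 1 by have [] := wP n.
  have := xd n; have := dh n; have := ler_normB (x n) (x n - ev e (y n)).
  rewrite subKr => ? ? ?; have := ler_normD (ev e (y n)) (x n - ev e (y n)).
  by rewrite addrC subrK; lra.
have yb : block y.
  move=> n; split.
    apply: contraTneq (y_ge n) => ->; rewrite ev0 normr0 -ltNge.
    by rewrite invr_gt0.
  have [_ _ + _] := wP n.+1; rewrite mkseqS last_rcons -/(y _) -/(y _).
  by apply: span_above => _ [i /= ni <-]; apply: above_leq ni _; exact: block_above.
exists x, y; split => //; first by move=> n; have [] := wP n.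
  by apply: bspan_sub => n; have [_ _ + _] := wP n; exact: span_image_sub.
have := biLip_perturb (block_basic eK yb) (C := 1) (t := ev e \o y) (s := x) (lexx _).
rewrite !mulr1; apply; first by apply/biLip_rangeP => n c; rewrite mul1r.
move=> n; rewrite distrC /=; apply: le_trans (ltW (xd n)) _.
have -> : d n = eps n / (4 * K) * 2^-1.
  by rewrite /d; field; rewrite gt_eqF.
by rewrite ler_wpM2l// divr_ge0// ?ltW ?eps_gt0 ?mulr_gt0.
Qed.

End Hump.

(** * Isomorphisms as biLipschitz relations *)

Section Isomorphism.
Context {R : realType} {E F : completeNormedModType R}.

Lemma linear_on_bounded (X : set E) (f : E -> F) : closed_subspace X ->
  linear_on X f -> {within X, continuous f} ->
  exists C, forall x, X x -> `|f x| <= C * `|x|.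
Proof.
move=> [[X0 Xlin] _] flin /subspace_continuousP fc; rewrite inE in X0.
have Xcomb a y z : X y -> X z -> X (a *: y + z).
  by move=> Xy Xz; have := Xlin a y z; rewrite !inE; exact.
have f0 : f 0 = 0.
  have := flin 1 0 0 X0 X0; rewrite !scale1r addr0 => /eqP.
  by rewrite addrC -subr_eq subrr eq_sym => /eqP.
have fZ a x : X x -> f (a *: x) = a *: f x.
  by move=> Xx; have := flin a x 0 Xx X0; rewrite !addr0 f0 addr0.
have /cvgrPdist_lt/(_ 1 ltr01) := fc 0 X0.
rewrite /within /= => /nbhs_ballP[d /= d0 dB].
exists (2 / d) => x Xx; have [->|x0] := eqVneq x 0; first by rewrite f0 !normr0 mulr0.
have nx : 0 < `|x| by rewrite normr_gt0.
have [t t0 tE] : exists2 t, 0 < t & t * `|x| = d / 2.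
  by exists (d / 2 / `|x|); [rewrite !divr_gt0|rewrite divfK// gt_eqF].
have Xtx : X (t *: x) by rewrite -[_ *: _]addr0; exact: Xcomb.
have dB' y : `|y| < d -> X y -> `|f 0 - f y| < 1.
  by move=> yd; apply: dB; rewrite -ball_normE /= sub0r normrN.
have := dB' (t *: x); rewrite f0 sub0r normrN fZ// !normrZ (gtr0_norm t0) tE.
move=> /(_ _ Xtx) H; have /ltW {}H : t * `|f x| < 1 by apply: H; lra.
rewrite -(ler_pM2l t0) mulrCA tE; apply: le_trans H _.
by rewrite le_eqVlt; apply/orP; left; apply/eqP; field; rewrite gt_eqF.
Qed.

End Isomorphism.

(** The inverse of a linear bijection is linear, so continuity bounds both maps; the constant
    dominates both bounds and 1. *)
Lemma isomorphic_biLip (R : realType) (E F : completeNormedModType R)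
    (X : set E) (Z : set F) :
  closed_subspace X -> closed_subspace Z -> isomorphic X Z -> exists C f, [/\ 1 <= C,
    forall x, X x -> Z (f x), forall z, Z z -> exists2 x, X x & f x = z &
    biLip C [set (x, f x) | x in X]].
Proof.
move=> Xc Zc [f [g [[fX gZ fK gK] [flin fc gc]]]].
have Xcomb a y z : X y -> X z -> X (a *: y + z).
  by move=> Xy Xz; have := Xc.1.2 a y z; rewrite !inE; exact.
have Zcomb a y z : Z y -> Z z -> Z (a *: y + z).
  by move=> Xy Xz; have := Zc.1.2 a y z; rewrite !inE; exact.
have fK' x : X x -> g (f x) = x by move=> Xx; apply: fK; rewrite inE.
have gK' x : Z x -> f (g x) = x by move=> Zx; apply: gK; rewrite inE.
have glin : linear_on Z g.
  move=> a x y Zx Zy; rewrite -{1}(gK' x)// -{1}(gK' y)// -flin; last 2 first.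
    exact: gZ.
    exact: gZ.
  by rewrite fK'//; apply: Xcomb; exact: gZ.
have [C HC] := linear_on_bounded Xc flin fc.
have [D HD] := linear_on_bounded Zc glin gc.
have X0 : X 0 by have := Xc.1.1; rewrite inE.
have f0 : f 0 = 0.
  have := flin 1 0 0 X0 X0; rewrite !scale1r addr0 => /eqP.
  by rewrite addrC -subr_eq subrr eq_sym => /eqP.
exists (1 + `|C| + `|D|), f; split.
- by rewrite -addrA lerDl addr_ge0.
- by move=> x Xx; exact: fX.
- by move=> z Zz; exists (g z); [exact: gZ|exact: gK'].
move=> w Sw; have [x Xx ->] : exists2 x, X x & w = (x, f x).
  elim: Sw => [|a _ _ [x Xx <-] _ [y Xy ->]]; first by exists 0; rewrite ?f0.
  by exists (a *: x + y); [exact: Xcomb|rewrite flin].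
split => /=.
  apply: le_trans (HC _ Xx) _; rewrite ler_wpM2r//.
  by apply: le_trans (ler_norm _) _; rewrite -addrA addrCA lerDl addr_ge0.
have := HD (f x) (fX _ Xx); rewrite fK'// => /le_trans; apply; rewrite ler_wpM2r//.
by apply: le_trans (ler_norm _) _; rewrite lerDr addr_ge0.
Qed.

Lemma infinite_dim_biLip (R : realType) (E F : completeNormedModType R)
    (X : set E) (Z : set F) C f : infinite_dim X -> (forall x, X x -> Z (f x)) ->
  biLip C [set (x, f x) | x in X] -> infinite_dim Z.
Proof.
move=> Xinf fX Cf [S [/finite_seqP[s ->] ZS]].
have [v [Xv vI]] := independent_seq Xinf.
pose u (i : 'I_(size s)) := nth 0 s i.
have [i|l [i li] l0] := @span_dependent _ _ (size s).+1 _ u (fun i => f (v i)) (ltnSn _).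
  have := ZS _ (fX _ (Xv i)); rewrite lspanE; apply: span_mono => x /= xs.
  by exists (Ordinal (etrans (index_mem x s) xs)) => //; rewrite /u /= nth_index.
pose c k := if insub k is Some j then l j else 0.
have cE (j : 'I_(size s).+1) : c j = l j by rewrite /c valK.
have fc0 : \sum_(j < (size s).+1) c j *: f (v j) = 0.
  by rewrite -[RHS]l0; apply: eq_bigr => j _; rewrite cE.
have [|_] := Cf (\sum_(j < (size s).+1) c j *: (v j, f (v j))).
  by apply: span_sum => j _; apply/spanZ/span_incl; exists (v j).
rewrite (pair_sum _ c v (f \o v)) /= fc0 normr0 mulr0 normr_le0 => /eqP/vI c0.
by move: li; rewrite -cE c0 ?eqxx.
Qed.

(** * From failure of tightness to winning strategies *)

Definition ivl (I : (nat -> nat) * (nat -> nat)) :=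
  forall j, (I.1 j <= I.2 j)%N /\ (I.2 j < I.1 j.+1)%N.

Definition gaps (I : (nat -> nat) * (nat -> nat)) (A : set nat) : set nat :=
  [set i | forall j, A j -> ~~ (I.1 j <= i <= I.2 j)%N].

(** Indices before the end of the first interval selected by [A] are excluded as well, so long
    intervals force the remaining vectors far out. *)
Definition gaps_after (I : (nat -> nat) * (nat -> nat)) (A : set nat) : set nat :=
  [set i | (exists2 j, A j & (I.2 j < i)%N) /\ gaps I A i].

Lemma ivl_lt I i j : ivl I -> (i < j)%N -> (I.2 i < I.1 j)%N.
Proof.
move=> Iv; elim: j => // j IH; rewrite ltnS leq_eqVlt => /predU1P[->|/IH ij].
  exact: (Iv j).2.
exact: ltn_trans (leq_trans ij (Iv j).1) (Iv j).2.
Qed.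

Lemma ivl_ge I j : ivl I -> (j <= I.1 j)%N.
Proof.
move=> Iv; elim: j => // j IH; apply: leq_ltn_trans (Iv j).2.
exact: leq_trans IH (Iv j).1.
Qed.

(** Each right end may depend on the left end already fixed, which allows every interval to swallow
    intervals of other sequences. *)
Lemma ivl_build (h : nat -> nat -> nat) :
  exists I, ivl I /\ forall j, (h j (I.1 j) <= I.2 j)%N.
Proof.
pose fix a j := if j is j'.+1 then (maxn (a j') (h j' (a j'))).+1 else 0%N.
exists (a, fun j => maxn (a j) (h j (a j))); split => j /=; last exact: leq_maxr.
by split; [exact: leq_maxl|exact: ltnSn].
Qed.

Lemma infinite_natP (A : set nat) :
  infinite_set A <-> forall m, exists2 j, A j & (m <= j)%N.
Proof.
split=> [Ainf m|H /finite_seqP[s sE]].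
  apply: contrapT => N; apply: Ainf; apply: (sub_finite_set _ (finite_II m)) => j Aj /=.
  by rewrite ltnNge; apply/negP => mj; apply: N; exists j.
have [j] := H (\max_(i <- s) i).+1; rewrite sE => /= js.
by rewrite ltnNge; move/negP; apply; exact: leq_bigmax_seq.
Qed.

Section Nontight.
Context {R : realType} {E : completeNormedModType R} {K : R} {e : nat -> E}.
Hypothesis eK : basic K e.

(** The constant is a natural number, so that states remain countable. *)
Definition partial_emb (C : nat) (p : seq (vec * vec)) := biLip (C%:R : R) (ev2 e @` [set` p]).

(** One copy of [Y], obtained from singleton intervals, yields [y] by a gliding hump. Its terms
    correspond to vectors [w n] of [Y]; for any other [I], the images of the [w n] in the copy
    avoiding [I] are perturbed to rational vectors. *)
Lemma nontight_blocks (z : nat -> vec) (Y : completeNormedModType R) : block z ->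
  infinite_dim [set: Y] -> ~ tight_in Y (ev e \o z) ->
  exists y, [/\ block y, bspan y `<=` bspan z & forall I, ivl I -> exists A (C : nat) r,
    [/\ infinite_set A, forall i, span (z @` gaps I A) (r i) &
      biLip (C%:R : R) (range (fun i => (ev e (y i), ev e (r i))))]].
Proof.
move=> zb Yinf Nt; have bK := block_basic eK zb; have K0 := basic_gt0 eK.
have Yc : closed_subspace [set: Y].
  by split; [split => [|a x y _ _]; rewrite inE|exact: closedT].
have emb I : ivl I -> exists2 A, infinite_set A &
    embeds [set: Y] (closed_lspan ((ev e \o z) @` gaps I A)).
  move=> Iv; apply: contrapT => N; apply: Nt.
  exists (fun j => [set i | (I.1 j <= i <= I.2 j)%N]); split.
    split=> [j|j m n /= /andP[_ mj] /andP[jn _]].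
      by exists (I.1 j), (I.2 j); split => //; exact: (Iv j).1.
    by apply: leq_ltn_trans mj _; apply: leq_trans jn; exact: (Iv j).2.
  move=> A Ainf Aemb; apply: N; exists A => //.
  suff <- : ~` (\bigcup_(j in A) [set i | (I.1 j <= i <= I.2 j)%N]) = gaps I A by [].
  apply/seteqP; split => i /= Hi.
    by move=> j Aj; apply/negP => ij; apply: Hi; exists j.
  by move=> [j Aj /= ij]; have := Hi j Aj; rewrite ij.
have embC I : ivl I -> exists A (C : R) (f : Y -> E), [/\ infinite_set A, 1 <= C,
    forall y, closed_lspan ((ev e \o z) @` gaps I A) (f y),
    closed_subspace (range f) & biLip C (range (fun y => (y, f y)))].
  move=> /emb[A Ainf [Z [ZA Zc Ziso]]].
  have [C [f [C1 fZ fsurj fC]]] := isomorphic_biLip Yc Zc Ziso.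
  exists A, C, f; split => //; first by move=> y; apply/ZA/fZ.
  suff -> : range f = Z by [].
  by apply/seteqP; split => [_ [y _ <-]|x /fsurj[y _ <-]]; [exact: fZ|exists y].
have [A0 [C0 [f0 [_ C01 f0z f0c f0C]]]] : exists A (C : R) (f : Y -> E),
    [/\ infinite_set A, 1 <= C, forall y, closed_lspan ((ev e \o z) @` gaps (id, id) A) (f y),
    closed_subspace (range f) & biLip C (range (fun y => (y, f y)))].
  by apply: embC => j /=; split.
have f0inf : infinite_dim (range f0).
  by apply: infinite_dim_biLip Yinf _ f0C => y _; exists y.
have [|x [y [fx yb yz yx]]] := hump_seq eK zb f0c f0inf.
  move=> _ [w _ <-]; have := f0z w; rewrite !closed_lspanE.
  by apply: closure_subset; exact: span_image_sub.
exists y; split => // I Iv.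
have [A [C [f [Ainf C1 fz _ fC]]]] := embC I Iv.
pose w n := s2val (cid2 (fx n)).
have wx n : f0 (w n) = x n := s2valP' (cid2 (fx n)).
have D0 : 0 < 2 * C0 * C by rewrite !mulr_gt0// (lt_le_trans ltr01).
(* The factors come from passing from [y] to [x], from [x] back to [Y], and from [Y] to the copy
   avoiding [I]. *)
set D := 2 * C0 * C in D0.
have yf : biLip D (range (fun n => (ev e (y n), f (w n)))).
  have C00 : 0 <= C0 by exact: le_trans C01.
  apply: (biLip_comp (v := w)); [by rewrite mulr_ge0|exact: le_trans C1| |].
    apply: (biLip_comp (v := x)) => //.
    apply: biLip_sub (biLip_flip f0C) => _ [n _ <-]; apply: span_incl.
    by exists (w n) => //=; rewrite wx.
  by apply: biLip_sub fC => _ [n _ <-]; apply: span_incl; exists (w n).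
have D1 : 1 <= D by rewrite /D; nra.
clearbody D.
have yK := block_basic eK yb.
pose d n : R := eps n / (4 * K * D) * `|ev e (y n)|.
have d0 n : 0 < d n.
  by rewrite mulr_gt0 ?(basic_norm_gt0 yK)// divr_gt0 ?eps_gt0// !mulr_gt0//.
have H n : {r | span (z @` gaps I A) r & `|f (w n) - ev e r| < d n}.
  apply: cid2; apply: closure_ev_dense (d0 n) _.
  by have := fz (w n); rewrite closed_lspanE image_comp.
exists A, (Num.truncn (2 * D)).+1, (fun n => s2val (H n)); split => //.
  by move=> i; exact: s2valP.
apply: (@biLip_le _ _ _ (2 * D)); first exact/ltW/truncnS_gt.
apply: (biLip_perturb yK D1 yf) => n; exact/ltW/(s2valP' (H n)).
Qed.
Lemma evZ a v : ev e (a *: v) = ratr a *: ev e v.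
Proof. by rewrite -[a *: v]addr0 ev_comb ev0 addr0. Qed.

Lemma rational_normalize v : 0 < `|ev e v| ->
  exists2 a : rat, a != 0 & 1 <= `|ev e (a *: v)| <= 2.
Proof.
move=> v0; have [|a] := @rat_in_itvoo R (`|ev e v|^-1) (2 / `|ev e v|).
  by rewrite ltr_pMl ?invr_gt0// ltr1n.
rewrite in_itv /= => /andP[a1 a2].
have a0 : 0 < ratr a :> R by apply: lt_trans a1; rewrite invr_gt0.
exists a; first by rewrite -(fmorph_eq0 (ratr : rat -> R)) gt_eqF.
rewrite evZ normrZ gtr0_norm//; apply/andP; split.
  by rewrite -ler_pdivrMr// mul1r ltW.
by rewrite -ler_pdivlMr// ltW.
Qed.

(* That [c] does not depend on [d] and [M] allows [unavoidable_init] to build its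
   intervals before any embedding is known. *)
Lemma shift_biLip (z : nat -> vec) N : block z -> exists c : nat, forall d M, (d + N <= M)%N ->
  exists w : nat -> vec, (forall i, exists a : rat, w i = a *: z (d + i).+1%N) /\
    biLip (c%:R : R) (ev2 e @` ([set (z i, w i) | i in [set i | (i < N)%N]] `|`
                                [set (z i, z i) | i in [set i | (M < i)%N]])).
Proof.
move=> zb; have zK := block_basic eK zb; have K0 := basic_gt0 eK.
(* The first summands bound [x'] by [x], the second ones [x] by [x']. The vectors [w i] have norms
   between 1 and 2, so [S] does not depend on [d]. Adding the common tail [t] leads to
   [S * K + K + 1]. *)
pose S : R := \sum_(i < N) (4 * K / `|ev e (z i)| + 2 * K * `|ev e (z i)|).
exists (Num.truncn (S * K + K + 1)).+1 => d M dM.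
have H i : {a : rat | a != 0 & 1 <= `|ev e (a *: z (d + i).+1%N)| <= 2}.
  by apply: cid2; apply: rational_normalize; exact: basic_norm_gt0 zK _.
pose w i := s2val (H i) *: z (d + i).+1%N.
have w0 i : s2val (H i) != 0 := s2valP (H i).
have wn i : 1 <= `|ev e (w i)| <= 2 := s2valP' (H i).
have wb : block w.
  have sb := block_shift zb d.+1.
  move=> i; split; first by rewrite scaler_eq0 negb_or w0 (zb _).1.
  move=> k; rewrite size_scale// => ki; rewrite coefZ.
  by have [_ ->] := sb i; rewrite ?mulr0// addnS.
have wK := block_basic eK wb.
exists w; split; first by move=> i; exists (s2val (H i)).
apply: biLip_le (ltW (truncnS_gt _)) _.
move=> v; rewrite image_setU => /spanU[p [q [Sp Sq ->]]].
have [c pE] : exists c : nat -> R,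
    p = (\sum_(i < N) c i *: ev e (z i), \sum_(i < N) c i *: ev e (w i)).
  have [|c' ->] := @span_ordP _ _ N (fun i => (ev e (z i), ev e (w i))) p.
    apply: span_mono Sp => _ [_ [i /= iN <-] <-].
    by exists (Ordinal iN).
  pose c k := if insub k is Some j then c' j else 0.
  exists c; rewrite -(pair_sum _ c (ev e \o z) (ev e \o w)).
  by apply: eq_bigr => i _; rewrite /c valK.
have [t [St qE]] : exists t, span ((ev e \o z) @` [set i | (M < i)%N]) t /\ q = (t, t).
  elim: Sq => [|a _ _ [_ [i /= Mi <-] <-] _ [t [St ->]]].
    by exists 0; split => //; exact: span0.
  by exists (a *: ev e (z i) + t); split => //; apply: span_cons => //; exists i.
rewrite {}pE {}qE /=; set x' := \sum_(i < N) _; set x := \sum_(i < N) _.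
have xt : `|x| <= K * `|x + t|.
  apply: (zK.2 N).
    by apply: span_sum => i _; apply/spanZ/span_incl; exists i => /=.
  apply: span_mono St => _ [i /= Mi <-]; exists i => //=; lia.
have xt' : `|x'| <= K * `|x' + t|.
  apply: (zK.2 M.+1).
    apply: span_sum => i _; rewrite evZ; do 2!apply: spanZ; apply: span_incl.
    by exists (d + i).+1%N => //=; have := ltn_ord i; lia.
  by apply: span_mono St => _ [i /= Mi <-]; exists i.
have cx i : (i < N)%N -> `|c i| <= 2 * K / `|ev e (z i)| * `|x|.
  move=> iN; rewrite mulrAC ler_pdivlMr ?(basic_norm_gt0 zK)//.
  exact: basic_coef zK c _ _ iN.
have cx' i : (i < N)%N -> `|c i| <= 2 * K * `|x'|.
  move=> iN; apply: le_trans (basic_coef wK c iN).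
  by rewrite ler_peMr//; case/andP: (wn i).
have S0 : 0 <= S.
  by apply: sumr_ge0 => i _; rewrite addr_ge0 ?divr_ge0 ?mulr_ge0// ltW.
have x'x : `|x'| <= S * `|x|.
  rewrite (le_trans (ler_norm_sum _ _ _))// mulr_suml; apply: ler_sum => i _.
  rewrite normrZ; case/andP: (wn i) => _ w2.
  apply: le_trans (ler_pM _ _ (cx i _) w2) _ => //.
  rewrite [leRHS]mulrDl; set y := `|ev e (z i)|; have y0 : 0 <= y by exact: normr_ge0.
  have -> : 2 * K / y * `|x| * 2 = 4 * K / y * `|x| by ring.
  by rewrite lerDl !mulr_ge0// ltW.
have xx' : `|x| <= S * `|x'|.
  rewrite (le_trans (ler_norm_sum _ _ _))// mulr_suml; apply: ler_sum => i _.
  rewrite normrZ; apply: le_trans (ler_wpM2r _ (cx' i _)) _ => //.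
  set y := `|ev e (z i)|; have y0 : 0 <= y by exact: normr_ge0.
  rewrite [leRHS]mulrDl [leLHS]mulrAC lerDr.
  by rewrite mulr_ge0 ?divr_ge0 ?mulr_ge0// ltW.
have t1 : `|t| <= `|x + t| + `|x|.
  have {1}-> : t = (x + t) - x by rewrite addrC addKr.
  exact: ler_normB.
have t2 : `|t| <= `|x' + t| + `|x'|.
  have {1}-> : t = (x' + t) - x' by rewrite addrC addKr.
  exact: ler_normB.
split.
  apply: le_trans (ler_normD _ _) _.
  have := ler_wpM2l S0 xt; rewrite 2!mulrDl mulrA; lra.
apply: le_trans (ler_normD _ _) _.
have := ler_wpM2l S0 xt'; rewrite 2!mulrDl mulrA; lra.
Qed.

(** No strategy is mentioned: a position is good if full embeddings of [y] extending [p] can dodge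
    any sequence of intervals. New vectors start behind a dodged interval, hence as far out as I
    demands. *)
Definition unavoidable (z y : nat -> vec) (C : nat) (f : seq vec) (p : seq (vec * vec)) :=
  forall I, ivl I -> exists A (r : nat -> vec),
  [/\ infinite_set A, forall i, span ([set` f] `|` (z @` gaps_after I A)) (r i),
    biLip (C%:R : R) (range (fun i => (ev e (y i), ev e (r i)))) &
    forall w, w \in p -> span (range (fun i => (y i, r i))) w].

(** Suppose [J C] defeats each constant [C], and build [I] whose intervals contain intervals of many
    [J C]. An embedding with constant [CT] dodges [I]; choose a dodged interval [j0 >= CT]. The
    vectors before it are shifted into it, behind an interval of [J C], at the cost of the factor
    [cst N]. The resulting constant is at most [C = j0 * cst N], and [J C] is dodged. *)
Lemma unavoidable_init (z y : nat -> vec) : block z ->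
  (forall I, ivl I -> exists A (C : nat) r,
    [/\ infinite_set A, forall i, span (z @` gaps I A) (r i) &
      biLip (C%:R : R) (range (fun i => (ev e (y i), ev e (r i))))]) ->
  exists C, unavoidable z y C [::] [::].
Proof.
move=> zb nt; apply: contrapT => Nuna.
pose target C I := exists A (r : nat -> vec), [/\ infinite_set A,
  forall i : nat, span (z @` gaps_after I A) (r i) &
  biLip (C%:R : R) (range (fun i => (ev e (y i), ev e (r i))))].
have HJ C : {J | ivl J & ~ target C J}.
  apply: cid2; apply: contrapT => N; apply: Nuna; exists C => J Jv.
  have [A [r [Ainf rA ry]]] : target C J.
    by apply: contrapT => NJ; apply: N; exists J.
  by exists A, r; split => // i; apply: span_mono (rA i) => v; right.
pose J C := s2val (HJ C).
have Jv C : ivl (J C) := s2valP (HJ C).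
have HC N : {c : nat | forall d M, (d + N <= M)%N ->
  exists w : nat -> vec, (forall i, exists a : rat, w i = a *: z (d + i).+1%N) /\
    biLip (c%:R : R) (ev2 e @` ([set (z i, w i) | i in [set i | (i < N)%N]] `|`
                                [set (z i, z i) | i in [set i | (M < i)%N]]))}.
  exact: cid (shift_biLip N zb).
pose cst N := sval (HC N).
have [I [Iv hI]] := ivl_build (fun j a =>
  (\max_(C < (j * cst a + j).+1) (J C).2 a + a)%N).
have JI j C : (C <= j * cst (I.1 j) + j)%N -> ((J C).2 (I.1 j) + I.1 j <= I.2 j)%N.
  move=> Cj; apply: leq_trans (hI j); rewrite leq_add2r.
  by rewrite -ltnS in Cj; exact: (leq_bigmax (F := fun i : 'I__ => (J i).2 _) (Ordinal Cj)).
have [A [CT [r [Ainf rA ry]]]] := nt I Iv.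
have Aub := proj1 (infinite_natP A) Ainf.
have [j0 Aj0 CTj0] := Aub CT.
set N := I.1 j0; pose C := (j0 * cst N)%N; pose d := (J C).2 N; pose M := I.2 j0.
have dM : (d + N <= M)%N by apply: JI; rewrite leq_addr.
have [w [wz wS]] := svalP (HC N) d M dM.
(* The interval of [J C] with number [I.1 j] lies inside the [j]-th interval of [I] for these [j]:
   at [j0] by the choice of [C], later because [C <= j]. *)
pose A' := [set I.1 j | j in [set j | A j /\ ((j == j0) || (j0 < j)%N && (C <= j)%N)]].
apply: (s2valP' (HJ C)).
pose P : set (vec * vec) := [set (z i, w i) | i in [set i | (i < N)%N]] `|`
  [set (z i, z i) | i in [set i | (M < i)%N /\ gaps I A i]].
have Hv i : {v | span P v & v.1 = r i}.
  apply: cid2; apply: (@span_lift _ _ _ fst); apply: span_mono (rA i) => _ [k Ak <-].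
  have := Ak j0 Aj0; rewrite negb_and -!ltnNge => /orP[kN|Mk].
    by exists (z k, w k) => //; left; exists k.
  by exists (z k, z k) => //; right; exists k.
have A'J j : [set j | A j /\ ((j == j0) || (j0 < j)%N && (C <= j)%N)] j ->
    ((J C).2 (I.1 j) + I.1 j <= I.2 j)%N.
  move=> [_ /orP[/eqP->|/andP[_ Cj]]]; apply: JI; first exact: leq_addr.
  by apply: leq_trans Cj _; exact: leq_addl.
have A'N : A' N by exists j0 => //; split => //; rewrite eqxx.
exists A', (fun i => (s2val (Hv i)).2); split.
- apply/infinite_natP => m; have [j Aj mj] := Aub (maxn m (maxn j0.+1 C)).
  exists (I.1 j); last by apply: leq_trans (ivl_ge j Iv); apply: leq_trans mj; exact: leq_maxl.
  exists j => //; split => //; apply/orP; right.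
  by move: mj; rewrite !geq_max => /and3P[_ -> ->].
- move=> i; apply: span_trans (span_linear snd (s2valP (Hv i))).
  move=> _ [_ [[k /= kN <-]|[k /= [Mk Ak] <-]] <-] /=.
    have [a ->] := wz k; apply/spanZ/span_incl; exists (d + k).+1%N => //; split.
      by exists N => //; rewrite -/d ltnS leq_addr.
    move=> _ [j [Aj jj0] <-]; rewrite negb_and -!ltnNge.
    case/orP: jj0 => [/eqP->|/andP[j0j _]]; apply/orP; [right|left].
      by rewrite -/N -/d ltnS leq_addr.
    apply: leq_trans (ivl_ge _ (Jv C)); apply: leq_ltn_trans (ivl_lt Iv j0j).
    by apply: leq_trans dM; rewrite -addnS leq_add2l.
  apply: span_incl; exists k => //; split.
    exists N => //; rewrite -/d; apply: leq_ltn_trans Mk; apply: leq_trans dM.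
    exact: leq_addr.
  move=> _ [j Aj <-]; apply: contra (Ak j Aj.1) => /andP[k1 k2]; apply/andP; split.
    exact: leq_trans (ivl_ge _ (Jv C)) k1.
  by apply: leq_trans k2 _; apply: leq_trans (A'J _ Aj); exact: leq_addr.
- apply: (@biLip_le _ _ _ (CT%:R * (cst N)%:R)).
    by rewrite -natrM ler_nat /C leq_mul2r CTj0 orbT.
  apply: (biLip_comp (v := ev e \o r)) => //.
  apply: biLip_sub wS => _ [i _ <-].
  have -> : ((ev e \o r) i, ev e (s2val (Hv i)).2) = ev2 e (s2val (Hv i)).
    by rewrite /ev2 /= (s2valP' (Hv i)).
  apply: ev2_span; apply: span_mono (s2valP (Hv i)) => u [Pu|[k [Mk _] <-]]; first by left.
  by right; exists k.
Qed.

Lemma unavoidable_emb z y C f p : unavoidable z y C f p -> partial_emb C p.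
Proof.
move=> H; have [|A [r [_ _ ry pr]]] := H (id, id); first by move=> j /=.
apply: biLip_sub ry => _ [w /= wp <-].
have := ev2_span e (pr w wp); apply: span_mono => _ [_ [i _ <-] <-].
by exists i.
Qed.

(** Otherwise every move, a chunk [G c d] with an answer of code [k], is refuted by some sequence
    [J c d k]. These countably many sequences are merged into one [I], and an embedding that dodges
    [I] provides a move whose own refutation it dodges. *)
Lemma unavoidable_step z y C f p n w : block z -> unavoidable z y C f p ->
  bspan y w -> exists g u,
  [/\ forall v, v \in g -> bspan z v /\ above n v,
      span [set` f ++ g] u & unavoidable z y C (f ++ g) (rcons p (w, u))].
Proof.
move=> zb H yw; apply: contrapT => N.
pose G c d := [seq z i | i <- iota c.+1 (d - c.+1)].
have GP c d i : (c < i < d)%N -> z i \in G c d.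
  move=> /andP[ci id]; apply: map_f; rewrite mem_iota ci subnKC//.
  exact: leq_trans ci (ltnW id).
pose target (f : seq vec) (p : seq (vec * vec)) I := exists A (r : nat -> vec),
  [/\ infinite_set A,
  forall i : nat, span ([set` f] `|` (z @` gaps_after I A)) (r i),
  biLip (C%:R : R) (range (fun i => (ev e (y i), ev e (r i)))) &
  forall w, w \in p -> span (range (fun i => (y i, r i))) w].
have HJ c d k : {J | ivl J & forall u, unpickle k = Some u ->
    ~ unavoidable z y C (f ++ G c d) (rcons p (w, u)) ->
    ~ target (f ++ G c d) (rcons p (w, u)) J}.
  apply: cid2; case: (unpickle k) => [u|]; last by exists (id, id) => // j /=.
  case: (pselect (unavoidable z y C (f ++ G c d) (rcons p (w, u)))) => [g|Ng].
    by exists (id, id) => [j /=|v [<-]].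
  apply: contrapT => NJ; apply: Ng => J Jv; apply: contrapT => NT.
  by apply: NJ; exists J => // v [<-].
pose J c d k := s2val (HJ c d k).
have Jv c d k : ivl (J c d k) := s2valP (HJ c d k).
(* The j-th interval is to contain the interval of index I.1 j of each of the
   finitely many [J c d k] with c, d <= I.1 j and k <= j; the answer u of II is
   taken into account from its code k = pickle u on. *)
have [I [Iv hI]] := ivl_build (fun j a =>
  (n + \max_(t : 'I_a.+1 * 'I_a.+1 * 'I_j.+1) (J t.1.1 t.1.2 t.2).2 a)%N).
have nI j : (n <= I.2 j)%N by apply: leq_trans (hI j); exact: leq_addr.
have JI j c d k : (c <= I.1 j)%N -> (d <= I.1 j)%N -> (k <= j)%N ->
    ((J c d k).2 (I.1 j) <= I.2 j)%N.
  rewrite -ltnS => cj; rewrite -ltnS => dj; rewrite -ltnS => kj.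
  apply: leq_trans (hI j); apply: leq_trans (leq_addl _ _).
  exact: (leq_bigmax (F := fun t : 'I_(I.1 j).+1 * 'I_(I.1 j).+1 * 'I_j.+1 =>
    (J t.1.1 t.1.2 t.2).2 (I.1 j)) (Ordinal cj, Ordinal dj, Ordinal kj)).
have [A [r [Ainf rA ry pr]]] := H I Iv.
have Aub := proj1 (infinite_natP A) Ainf.
have [j0 Aj0 j0min] : exists2 j, A j & forall j', A j' -> (j <= j')%N.
  have [j Aj _] := Aub 0%N.
  have exA : exists j, `[< A j >] by exists j; apply/asboolP.
  case: (ex_minnP exA) => m /asboolP Am mmin; exists m => // j' Aj'.
  by apply: mmin; apply/asboolP.
have [v Sv vw] : exists2 v, span (range (fun i => (y i, r i))) v & v.1 = w.
  apply: (@span_lift _ _ _ fst); apply: span_mono yw => _ [i _ <-].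
  by exists (y i, r i) => //; exists i.
pose u := v.2.
have uA : span ([set` f] `|` (z @` gaps_after I A)) u.
  apply: span_trans (span_linear snd Sv) => _ [_ [i _ <-] <-] /=; exact: rA.
have [m um] := span_bounded_support uA.
have [j1 Aj1] := Aub (maxn m (maxn (pickle u) j0.+1)).
rewrite !geq_max => /and3P[mj1 uj1 j0j1].
(* The chunk runs from the end of the first dodged interval to the start of a later one, [j1], past
   all [z i] used in [u] and with [pickle u <= j1]. The remaining vectors lie behind interval [j1],
   which contains an interval of the refutation for [u]. *)
set c := I.2 j0; set d := I.1 j1.
have cd : (c < d)%N by exact: ivl_lt.
have inG i : gaps_after I A i -> (i < d)%N -> z i \in G c d.
  move=> [[j Aj ji] _] id; apply: GP; rewrite id andbT; apply: leq_ltn_trans ji.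
  have := j0min _ Aj; rewrite leq_eqVlt => /predU1P[<-//|j0j].
  by apply: ltnW; apply: leq_trans (ivl_lt Iv j0j) (Iv j).1.
apply: N; exists (G c d), u; split.
- move=> _ /mapP[i + ->]; rewrite mem_iota => /andP[ci _]; split; first exact: block_incl.
  exact: above_leq (leq_trans (nI j0) (ltnW ci)) (@block_above _ zb i).
- apply: span_mono um => x [xf|[i [Ai im] <-]] /=; rewrite mem_cat.
    by rewrite [_ \in _]xf.
  apply/orP; right; apply: inG => //; apply: leq_trans im _.
  by apply: leq_trans mj1 _; exact: ivl_ge.
apply: contrapT => Ng; apply: (s2valP' (HJ c d (pickle u)) u (pickleK u) Ng).
rewrite -/(J c d (pickle u)); set J' := J c d (pickle u).
have J'I j : (j1 <= j)%N -> (J'.2 (I.1 j) <= I.2 j)%N.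
  move=> j1j; have dj : (d <= I.1 j)%N.
    move: j1j; rewrite leq_eqVlt => /predU1P[<-//|j1j].
    by apply: leq_trans (Iv j1).1 _; apply: ltnW; exact: ivl_lt.
  by apply: JI => //; [exact: leq_trans (ltnW cd) dj|exact: leq_trans uj1 j1j].
exists [set I.1 j | j in [set j | A j /\ (j1 <= j)%N]], r; split => //.
- apply/infinite_natP => k; have [j Aj] := Aub (maxn k j1).
  rewrite geq_max => /andP[kj j1j]; exists (I.1 j); first by exists j.
  by apply: leq_trans kj _; exact: ivl_ge.
- move=> i; apply: span_mono (rA i) => x [xf|[k Ak <-]].
    by left; rewrite /= mem_cat [_ \in f]xf.
  case: (ltnP k d) => kd; first by left; rewrite /= mem_cat inG// orbT.
  have Ik : (I.2 j1 < k)%N.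
    by have := Ak.2 j1 Aj1; rewrite -/d kd /= -ltnNge.
  right; exists k => //; split.
    exists d; first by exists j1.
    by apply: leq_ltn_trans Ik; exact: J'I.
  move=> _ [j [Aj j1j] <-]; apply: contra (Ak.2 j Aj) => /andP[k1 k2].
  apply/andP; split; first exact: leq_trans (ivl_ge _ (Jv _ _ _)) k1.
  by apply: leq_trans k2 _; exact: J'I.
- move=> x; rewrite mem_rcons inE => /predU1P[->|/pr//].
  by rewrite -vw -surjective_pairing.
Qed.

Lemma nontight_win (z : nat -> vec) (Y : completeNormedModType R) : block z ->
  infinite_dim [set: Y] -> ~ tight_in Y (ev e \o z) ->
  exists C y, [/\ block y, bspan y `<=` bspan z & Win partial_emb C z (bspan y) [::] [::]].
Proof.
move=> zb Yinf Yt; have [y [yb yz nt]] := nontight_blocks zb Yinf Yt.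
have [C gC] := unavoidable_init zb nt; exists C, y; split => //.
exists (unavoidable z y C); split => // f p fp; split; first exact: unavoidable_emb fp.
by move=> n w yw; exact: unavoidable_step.
Qed.

End Nontight.

(** * From plays of the game to a minimal subspace *)

Lemma biLip_chain (R : realType) (E : completeNormedModType R) (e : nat -> E) (D : R)
    (L : nat -> seq (vec * vec)) : (forall n, {subset L n <= L n.+1}) ->
  (forall n, biLip D (ev2 e @` [set` L n])) ->
  biLip D (ev2 e @` [set w | exists n, w \in L n]).
Proof.
move=> LS LD w Sw.
have Lm m n : (m <= n)%N -> {subset L m <= L n}.
  elim: n => [|n IH]; first by rewrite leqn0 => /eqP->.
  by rewrite leq_eqVlt => /predU1P[->//|/IH mn x /mn /LS].
suff [n Sn] : exists n, span (ev2 e @` [set` L n]) w by exact: LD Sn.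
elim: Sw => [|a _ y [v [m vm] <-] _ [n Sn]]; first by exists 0%N; exact: span0.
exists (maxn m n); apply: span_cons.
  by exists v => //=; apply: Lm vm; exact: leq_maxl.
apply: span_mono Sn => _ [v' v'n <-]; exists v' => //=.
by apply: Lm v'n; exact: leq_maxr.
Qed.

Lemma block_Xn : block (fun n => 'X^n).
Proof.
move=> n; split; first by rewrite -size_poly_gt0 size_polyXn.
by move=> i; rewrite size_polyXn coefXn => /ltn_eqF ->.
Qed.

Theorem theorem1p1 (R : realType) (E : completeNormedModType R)
    (E_infinite_dim : infinite_dim [set: E])
    (E_no_minimal : ~ exists X : set E, banach_subspace X /\ minimal_space X) :
  exists X : set E, banach_subspace X /\ tight_space X.
Proof.
apply: contrapT => not_tight; apply: E_no_minimal.
have Ec : closed_subspace [set: E].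
  by split; [split => [|a x y _ _]; rewrite inE|exact: closedT].
have [e [eK _ _]] := mazur Ec E_infinite_dim.
have [|y [yb _ ymin]] := game_minimal (partial_emb := @partial_emb R E e) block_Xn.
  move=> z zb _; have zK := block_basic eK zb.
  (* Otherwise the block sequence is a tight basis of its closed span. *)
  have [Y [Yinf Yt]] : exists Y : completeNormedModType R,
      infinite_dim [set: Y] /\ ~ tight_in Y (ev e \o z).
    apply: contrapT => NY; apply: not_tight.
    exists (closed_lspan (range (ev e \o z))); split; first exact: basic_banach zK.
    exists (ev e \o z); split; first exact: basic_schauder zK.
    by move=> Y Yinf; apply: contrapT => Yt; apply: NY; exists Y.
  exact (nontight_win eK zb Yinf Yt).
have yK := block_basic eK yb.
exists (closed_lspan (range (ev e \o y))); split; first exact: basic_banach yK.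
move=> X XY [Xc Xinf].
(* The game concerns block sequences only, so a block sequence [z] of [y] is found with an
   equivalent copy [x] inside the arbitrary subspace [X]. *)
have [x [z [Xx zb zy zx]]] := hump_seq eK yb Xc Xinf XY.
have [C [p [q [[pS qS pqC pq qz] p0]]]] := ymin z zb zy.
have pL n : {subset p n <= p n.+1}.
  by move=> s sp; have [t -> _] := pS n; rewrite mem_rcons inE sp orbT.
have qL n : {subset q n <= q n.+1}.
  by move=> s sp; have [t ->] := qS n; rewrite mem_cat sp.
have pC := biLip_chain pL (fun n => (pqC n).1).
have qC := biLip_chain qL (fun n => (pqC n).2).
have Hu n : {u : vec | (y n, u) \in p n.+1}.
  apply: cid; have [s -> sy] := pS n; exists s.2.
  by rewrite mem_rcons inE -sy -surjective_pairing eqxx.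
pose u n := sval (Hu n).
(* [u n] is a combination of first entries of [q]; the same combination of second entries is its
   image in [bspan z]. *)
have Hv n : {v : vec * vec | span [set w | exists m, w \in q m] v & v.1 = u n}.
  apply: cid2; apply: (@span_lift _ _ _ fst).
  apply: span_mono (pq _ _ (svalP (Hu n))) => s /= /mapP[w wq ->].
  by exists w => //; exists n.+1.
pose v n := s2val (Hv n).
have vz n : bspan z (v n).2.
  apply: span_trans (span_linear snd (s2valP (Hv n))) => _ [w [m wq] <-].
  exact: qz wq.
have Ht n : {w : E * E | span (range (fun k => (ev e (z k), x k))) w & w.1 = ev e (v n).2}.
  apply: cid2; apply: (@span_lift _ _ _ fst); apply: span_mono (ev_span e (vz n)).
  by move=> _ [_ [k _ <-] <-]; exists (ev e (z k), x k) => //; exists k.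
pose t n := (s2val (Ht n)).2.
(* Three maps are composed: [p] from [y] to [u] and [q] from [u] into [bspan z], each with constant
   [C], then the copy of [z] in [X] with constant 2. *)
have yt : biLip (C%:R * C%:R * 2) (range (fun n => (ev e (y n), t n))).
  apply: (biLip_comp (v := fun n => ev e (v n).2)); [by rewrite mulr_ge0|by []| |].
    apply: (biLip_comp (v := fun n => ev e (u n))) => //.
      apply: biLip_sub pC => _ [n _ <-]; apply: span_incl.
      by exists (y n, u n) => //; exists n.+1; exact: svalP (Hu n).
    apply: biLip_sub qC => _ [n _ <-].
    have -> : (ev e (u n), ev e (v n).2) = ev2 e (v n) by rewrite /ev2 (s2valP' (Hv n)).
    exact: ev2_span (s2valP (Hv n)).
  apply: biLip_sub zx => _ [n _ <-].
  by rewrite -(s2valP' (Ht n)) -surjective_pairing; exact: s2valP (Ht n).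
exists (closed_lspan (range t)); split.
- apply: closed_lspan_min => // _ [n _ <-].
  have Xspan : closed_lspan (range x) `<=` X.
    by apply: closed_lspan_min => // _ [k _ <-].
  apply: Xspan; rewrite closed_lspanE; apply: subset_closure.
  apply: span_trans (span_linear snd (s2valP (Ht n))) => _ [_ [k _ <-] <-].
  by apply: span_incl; exists k.
- exact: closed_lspan_subspace.
- have := biLip_isomorphic yt.
  have -> : fst @` range (fun n => (ev e (y n), t n)) = range (ev e \o y).
    by rewrite image_comp.
  by have -> : snd @` range (fun n => (ev e (y n), t n)) = range t by rewrite image_comp.
Qed.
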